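(* Let $S=\{-1,+1\}$, $\beta>0$, and let $\mathcal{K}:\mathbb{Z}^d\to\mathbb{R}$ be symmetric ($\mathcal{K}(-k)=\mathcal{K}(k)$) and of finite range $R>0$ ($\mathcal{K}(k)=0$ whenever $\|k\|_1>R$). Let $P$ be the PCA dynamics on $\{-1,+1\}^{\mathbb{Z}^d}$ with updating rule $$p_k(s|\eta)=\tfrac12\Big(1+s\tanh\big(\beta\sum_{k'\in\mathbb{Z}^d}\mathcal{K}(k'-k)\eta_{k'}\big)\Big),\qquad k\in\mathbb{Z}^d,\ s\in S,\ \eta\in S^{\mathbb{Z}^d},$$ and assume that $P$ is attractive. Let $\varphi$ be the potential defined by $\varphi_{U_k}(\sigma_{U_k})=-\log\cosh\big(\beta\sum_j\mathcal{K}(k-j)\sigma_j\big)$ with $U_k=\{j:\mathcal{K}(k-j)\ne0\}$, $k\in\mathbb{Z}^d$, and $\varphi_\Lambda=0$ for all other finite $\Lambda$, and let $\mathcal{G}(\varphi)$ be the set of Gibbs measures on $S^{\mathbb{Z}^d}$ associated with $\varphi$. (1) If $\#\mathcal{G}(\varphi)>1$, then $P$ is non-ergodic. (2) If $\mathcal{G}(\varphi)=\{\mu\}$, then $P$ is ergodic towards $\mu$. If moreover the following weak mixing condition holds: there exist $C>0$, $M>0$ such that for all $L\ge2$, $$\int\sigma_0\,\mu(d\sigma_{\mathcal{B}(L)}|\sigma_{\mathcal{B}(L)^c}=+1)-\int\sigma_0\,\mu(d\sigma_{\mathcal{B}(L)}|\sigma_{\mathcal{B}(L)^c}=-1)\le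 Ce^{-ML},$$ then the convergence towards $\mu$ holds with exponential rate: there exist $\lambda>0$ and $n_1$ such that for all $n\ge n_1$ and all local functions $f$ on $S^{\mathbb{Z}^d}$, $$\sup_{\sigma}\big|\delta_\sigma P^{(n)}(f)-\mu(f)\big|\le2\,|||f|||\,e^{-\lambda n}.$$
   Context: A PCA dynamics on $S^{\mathbb{Z}^d}$ with updating rule $(p_k)_{k\in\mathbb{Z}^d}$ is the discrete-time Markov chain with kernel $P(d\sigma|\eta)=\bigotimes_{k\in\mathbb{Z}^d}p_k(d\sigma_k|\eta)$. Write $P(f)(\eta)=\int f(\sigma)P(d\sigma|\eta)$, $\nu P(d\sigma)=\int P(d\sigma|\eta)\nu(d\eta)$, $\nu P^{(n)}=(\nu P^{(n-1)})P$. $\nu$ is stationary if $\nu P=\nu$. $P$ is ergodic (towards $\nu$) if $\nu$ is its unique stationary probability measure and $\rho P^{(n)}\to\nu$ weakly for every initial probability measure $\rho$. $P$ is attractive if $P(f)$ is increasing for every increasing $f$, where configurations are ordered coordinatewise; for the dynamics considered here this is equivalent to $\mathcal{K}\ge0$. For finite $\Lambda\subset\mathbb{Z}^d$ and $\tau\in S^{\mathbb{Z}^d}$ the finite volume Gibbs measure is $\mu_\Lambda^\tau(\sigma_\Lambda)=\frac1{Z_\Lambda^\tau}\exp\big(-\sum_{A\cap\Lambda\ne\emptyset}\varphi_A(\sigma_\Lambda\tau_{\Lambda^c})\big)$ (sum over finite $A\subset\mathbb{Z}^d$, $Z_\Lambda^\tau$ normalising). A probability measure $\mu$ on $S^{\mathbb{Z}^d}$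 is in $\mathcal{G}(\varphi)$ iff for every finite $\Lambda$ a version of $\mu(d\sigma_\Lambda|\sigma_{\Lambda^c})$ is $\mu_\Lambda^{\sigma_{\Lambda^c}}(d\sigma_\Lambda)$. Accordingly $\mu(d\sigma_{\mathcal{B}(L)}|\sigma_{\mathcal{B}(L)^c}=\pm1)$ means $\mu_{\mathcal{B}(L)}^{\tau}$ with $\tau\equiv\pm1$. $\mathcal{B}(L)=\{k\in\mathbb{Z}^d:\|k\|_1\le L\}$, $\|k\|_1=\sum_i|k_i|$. A function on $S^{\mathbb{Z}^d}$ is local if it depends on finitely many coordinates; $\Delta_f(k)=\sup\{|f(\sigma)-f(\eta)|:\sigma_j=\eta_j\ \forall j\neq k\}$ and $|||f|||=\sum_{k\in\mathbb{Z}^d}\Delta_f(k)$. *)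

(* Defs.v *)
From HB Require Import structures.
From mathcomp Require Import all_boot all_order all_algebra finmap.
From mathcomp Require Import all_classical all_reals all_analysis.
From mathcomp Require Import giry.

Set Implicit Arguments.
Unset Strict Implicit.
Unset Printing Implicit Defensive.

Import Order.TTheory GRing.Theory Num.Theory.
Import numFieldNormedType.Exports.

Local Open Scope classical_set_scope.
Local Open Scope ring_scope.

Section hyperbolic.
Context {R : realType}.
Implicit Type x : R.

Definition cosh x : R := (expR x + expR (- x)) / 2.

Definition tanh x : R := (expR x - expR (- x)) / (expR x + expR (- x)).

End hyperbolic.

Section evolution.
Context d (T : measurableType d) (R : realType).
Variable P : R.-pker T ~> T.
Local Open Scope ereal_scope.

Definition step (nu : probability T R) (A : set T) : \bar R :=
  \int[nu]_x P x A.

Section step_probability.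
Variable nu : probability T R.

Let step0 : step nu set0 = 0.
Proof. by apply: integral0_eq => x _; rewrite measure0. Qed.

Let step_ge0 A : 0 <= step nu A.
Proof. by apply: integral_ge0 => x _; exact: measure_ge0. Qed.

Let step_additive : semi_sigma_additive (step nu).
Proof.
move=> F mF tF mUF.
have -> : step nu (\bigcup_n F n) = \sum_(0 <= n <oo) step nu (F n).
  rewrite /step -integral_nneseries//; last first.
    by move=> n; exact: measurable_kernel.
  apply: eq_integral => x _; apply/esym/cvg_lim => //.
  exact: measure_semi_sigma_additive.
apply: is_cvg_ereal_nneg_natsum => n _; exact: step_ge0.
Qed.

HB.instance Definition _ := isMeasure.Build _ _ _ (step nu)
  step0 step_ge0 step_additive.

Let step_setT : step nu [set: T] = 1.
Proof.
rewrite /step (eq_integral (cst 1)) => [|x _]; last exact: prob_kernel.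
by rewrite integral_cst// mul1e; exact: probability_setT.
Qed.

HB.instance Definition _ := Measure_isProbability.Build _ _ _ (step nu)
  step_setT.

End step_probability.

Fixpoint evolve (nu : probability T R) (n : nat) : probability T R :=
  if n is m.+1 then step (evolve nu m) else nu.

(* Only the values of a measure on measurable sets are meaningful, so measures
   are compared with [measure_eq] throughout. *)
Definition stationary (nu : probability T R) : Prop := measure_eq (step nu) nu.

Definition kernel_op (f : T -> R) (x : T) : R := (\int[P x]_y f y)%R.

End evolution.

Notation site d := 'rV[int]_d.

Section configurations.
Variable d : nat.

Definition norm1 (k : site d) : nat := (\sum_(i < d) `|k ord0 i|)%N.

(* The ball is finite: see [finite_ball1]. *)
Definition ball1 (L : nat) : {fset site d} :=
  fset_set [set k : site d | (norm1 k <= L)%N].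

(* [true] stands for the spin +1 and [false] for the spin -1. *)
Definition coord_events (D : set (site d)) : set (set (site d -> bool)) :=
  [set A | exists k s, D k /\ A = [set sigma | sigma k = s]].

(* Spin configurations, with the product sigma-algebra. *)
Definition config := g_sigma_algebraType (coord_events [set: site d]).

(* Configurations, with the sigma-algebra generated by the spins in D. *)
Definition config_on (D : set (site d)) :=
  g_sigma_algebraType (coord_events D).

Definition const_config (s : bool) : config := fun _ => s.

Definition patch (Lambda : {fset site d}) (zeta : {ffun Lambda -> bool})
    (tau : config) : config :=
  fun k => if insub k is Some i then zeta i else tau k.

Lemma finite_ball1 (L : nat) : finite_set [set k : site d | (norm1 k <= L)%N].
Proof.
pose g (f : {ffun 'I_d -> 'I_(L + L).+1}) : site d :=
  \row_i ((f i)%:Z - L%:Z).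
apply: (sub_finite_set (B := range g)); last exact: finite_image.
move=> k /= kL.
have le_coord i : (`|k ord0 i| <= L)%N.
  by apply: leq_trans kL; rewrite /norm1 (bigD1 i)//= leq_addr.
have bnd i : 0 <= k ord0 i + L%:Z <= (L + L)%:Z.
  have : `|k ord0 i| <= L%:Z by rewrite -abszE lez_nat le_coord.
  rewrite ler_norml => /andP[l u]; rewrite -lerBlDr sub0r l /=.
  by rewrite PoszD lerD2r.
exists [ffun i => inord (absz (k ord0 i + L%:Z))] => //.
apply/rowP => i; rewrite mxE ffunE inordK.
  by have /andP[l _] := bnd i; rewrite gez0_abs// addrK.
by have /andP[l u] := bnd i; rewrite ltnS -lez_nat gez0_abs.
Qed.

End configurations.

Section spin_systems.
Context {R : realType} {d : nat}.
Implicit Types (sigma eta tau : config d) (Lambda : {fset site d}).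

Definition spin (s : bool) : R := if s then 1 else -1.

Definition local_fun (f : config d -> R) : Prop :=
  exists Lambda, forall sigma eta,
    (forall k, k \in Lambda -> sigma k = eta k) -> f sigma = f eta.

Definition oscillation (f : config d -> R) (k : site d) : \bar R :=
  ereal_sup [set x | exists sigma eta,
    (forall j, j != k -> sigma j = eta j) /\ x = `|f sigma - f eta|%:E].

Definition triple_norm (f : config d -> R) : \bar R :=
  \esum_(k in [set: site d]) oscillation f k.

Definition coord_increasing (f : config d -> R) : Prop :=
  forall sigma eta, (forall k, sigma k ==> eta k) -> f sigma <= f eta.

(* An increasing function is bounded by its values at the two constant
   configurations, so integrability only requires measurability. *)
Definition attractive (P : R.-pker config d ~> config d) : Prop :=
  forall f : config d -> R, measurable_fun [set: config d] f ->
    coord_increasing f -> coord_increasing (kernel_op P f).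

(* Continuity is for the product of the discrete topologies on the spins; this
   space is compact, so continuous functions are bounded. *)
Definition weak_cvg (nu_ : nat -> probability (config d) R)
    (nu : probability (config d) R) : Prop :=
  forall f : config d -> R,
    continuous (f : {ptws site d -> bool} -> R) ->
    (\int[nu_ n]_sigma f sigma)%R @[n --> \oo] --> (\int[nu]_sigma f sigma)%R.

Definition ergodic_towards (P : R.-pker config d ~> config d)
    (nu : probability (config d) R) : Prop :=
  [/\ stationary P nu,
      forall rho, stationary P rho -> measure_eq rho nu
    & forall rho, weak_cvg (evolve P rho) nu].

Definition ergodic (P : R.-pker config d ~> config d) : Prop :=
  exists nu, ergodic_towards P nu.

(* P(. | eta) is the product over the sites k of the laws p k (. | eta): this
   determines P(. | eta), as the cylinders generate the sigma-algebra. *)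
Definition pca_dynamics (p : site d -> bool -> config d -> R)
    (P : R.-pker config d ~> config d) : Prop :=
  forall eta Lambda (zeta : config d),
    P eta [set sigma | forall k, k \in Lambda -> sigma k = zeta k] =
    (\prod_(k <- Lambda) p k (zeta k) eta)%:E.

(* A potential; [phi A sigma] is meant to depend only on the restriction of
   sigma to A. *)
Definition potential := {fset site d} -> config d -> R.

Section gibbs.
Variable phi : potential.

(* The sum is over the finite sets A that meet Lambda; it has finite support
   for a potential of finite range. *)
Definition hamiltonian Lambda sigma : R :=
  \sum_(A \in [set A : {fset site d} | (A `&` Lambda)%fset != fset0])
    phi A sigma.

Definition boltzmann Lambda tau (zeta : {ffun Lambda -> bool}) : R :=
  expR (- hamiltonian Lambda (patch zeta tau)).

Definition partition_fun Lambda tau : R :=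
  \sum_(zeta : {ffun Lambda -> bool}) boltzmann tau zeta.

Definition gibbs_fin Lambda tau (zeta : {ffun Lambda -> bool}) : R :=
  boltzmann tau zeta / partition_fun Lambda tau.

Definition gibbs_fin_int Lambda tau (f : config d -> R) : R :=
  \sum_(zeta : {ffun Lambda -> bool}) f (patch zeta tau) * gibbs_fin tau zeta.

(* [gibbs_fin] is a version of the conditional law of the spins in Lambda given
   the spins outside Lambda. *)
Definition gibbs (mu : probability (config d) R) : Prop :=
  forall Lambda (zeta : {ffun Lambda -> bool}),
    measurable_fun [set: config_on (~` [set` Lambda])]
      (fun tau => gibbs_fin tau zeta) /\
    forall B : set (config d),
      measurable (B : set (config_on (~` [set` Lambda]))) ->
      mu ([set sigma | forall i : Lambda, sigma (val i) = zeta i] `&` B) =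
      (\int[mu]_(tau in B) (gibbs_fin tau zeta)%:E)%E.

Definition weak_mixing : Prop :=
  exists C M : R, [/\ 0 < C, 0 < M & forall L : nat, (2 <= L)%N ->
    gibbs_fin_int (ball1 d L) (const_config true) (fun s => spin (s 0)) -
    gibbs_fin_int (ball1 d L) (const_config false) (fun s => spin (s 0)) <=
    C * expR (- M * L%:R)].

End gibbs.

Section ising_pca.
Variables (beta : R) (K : site d -> R).

Definition pca_rule (k : site d) (s : bool) (eta : config d) : R :=
  2^-1 * (1 + spin s *
    tanh (beta * \sum_(k' \in [set: site d]) K (k' - k) * spin (eta k'))).

Definition nbhd (k : site d) : set (site d) := [set j | K (k - j) != 0].

Definition local_energy (k : site d) sigma : R :=
  - ln (cosh (beta * \sum_(j \in [set: site d]) K (k - j) * spin (sigma j))).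

(* For K <> 0 of finite range the sets [nbhd k] are pairwise distinct, and for
   K = 0 the energies [local_energy k] are all 0: see [pca_potential_nbhd]. *)
Definition pca_potential : potential := fun A sigma =>
  if pselect (exists k, nbhd k = [set` A]) is left ex_k
  then local_energy (projT1 (cid ex_k)) sigma else 0.

End ising_pca.

End spin_systems.

Lemma pca_potential_nbhd (R : realType) (d : nat) (beta : R) (K : site d -> R)
    (A : {fset site d}) (k : site d) (sigma : config d) :
  nbhd K k = [set` A] ->
  pca_potential beta K A sigma = local_energy beta K k sigma.
Proof.
move=> kA; rewrite /pca_potential; case: pselect => [ex_k|nex_k]; last first.
  by exfalso; apply: nex_k; exists k.
case: (cid ex_k) => l /= lA.
have memA m (mA : nbhd K m = [set` A]) j : (j \in A) = (K (m - j) != 0).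
  apply/idP/idP => h; first by have : nbhd K m j by rewrite mA.
  by have : [set` A] j by rewrite -mA.
have shiftA j : (j \in A) = (j + (l - k) \in A).
  by rewrite (memA _ kA) (memA _ lA) opprD opprB addrCA [l + _]addrC subrK addrC.
have [A0|/fset0Pn[a aA]] := eqVneq A fset0.
  have K0 m : K m = 0.
    apply/eqP; have := memA _ kA (k - m); rewrite A0 in_fset0 subKr.
    by move/esym/negbFE.
  by congr (- ln (cosh (_ * _))); apply: eq_fsbigr => j _; rewrite !K0 !mul0r.
suff -> : l = k by [].
apply/eqP; rewrite -subr_eq0; set t := l - k in shiftA *.
have permA : perm_eq (enum_fset A) [seq j + t | j <- enum_fset A].
  apply: uniq_perm; first exact: fset_uniq.
    by rewrite map_inj_uniq ?fset_uniq//; exact: addIr.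
  move=> j; apply/idP/mapP => [jA|[i iA ->]]; last by rewrite -shiftA.
  by exists (j - t); rewrite ?subrK// shiftA subrK.
have := perm_big _ permA (op := +%R) (x := 0 : site d) (P := xpredT) (F := id).
rewrite big_map big_split/= -{1}[LHS]addr0 => /addrI/esym.
rewrite big_const_seq count_predT iter_addr_0 => t0.
apply/eqP/rowP => i; move/rowP/(_ i)/eqP : t0; rewrite mulmxnE !mxE.
have Agt0 : (0 < size (enum_fset A))%N by case: (enum_fset A) (aA : a \in enum_fset A).
by rewrite mulrn_eq0 eqn0Ngt Agt0 => /eqP.
Qed.

(* Main.v *)
(* Under the weight exp(beta sum_(k,j) K(k-j) eta_k sigma_j) the conditional law of
   either of sigma, eta given the other is that of one step of the dynamics, and
   summing out eta leaves the Gibbs weight prod_k cosh(beta sum_j K(k-j) sigma_j).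
   Hence two steps of the dynamics preserve the finite volume Gibbs measures with
   any boundary condition on functions of the spins in the box, and every Gibbs
   measure is invariant under P^2: an ergodic P leaves room for one Gibbs measure.

   If the spins outside a box are reset to +1 every second step, attractiveness
   makes the resulting finite chain dominate P, while it converges to the finite
   volume measure with boundary condition +1; symmetrically for -1. By compactness
   and uniqueness these measures both approach mu, so P is squeezed to mu, uniformly
   in the initial configuration.

   For the rate, let rho(n) be the difference of the expected spin at the origin
   after n steps from the two constant configurations. Resetting the spins outside
   the box of radius L after n steps, and comparing with mu, gives
     rho(n + 2m) <= C exp(-M L) + (2L+1)^d rho(2m) rho(n) / 2.
   Once rho is small enough, letting L grow proportionally to the time turns this
   inequality into exponential decay. *)
Require Import Defs.
From HB Require Import structures.
From mathcomp Require Import all_boot all_order all_algebra finmap.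
From mathcomp Require Import all_classical all_reals all_analysis.
From mathcomp Require Import giry measurable_realfun.
From mathcomp Require Import ring lra.

Set Implicit Arguments.
Unset Strict Implicit.
Unset Printing Implicit Defensive.

Import Order.TTheory GRing.Theory Num.Theory.
Import numFieldNormedType.Exports.

Local Open Scope classical_set_scope.
Local Open Scope ring_scope.

Local Notation patch := Defs.patch.

(** * Local functions *)

(** Everything is computed on functions of finitely many spins: against a measure of mass one their
    integral is a finite sum over patterns, so exchanging sums replaces Fubini, and such integrals
    determine the measure. The finite volume balance pairs the spins of a box with those of a larger
    set of neighbouring sites, so it is not symmetric between two consecutive times: one step leaves
    the box and the next returns to it. This is why even times are controlled first; invariance of
    [mu] under a single step comes out afterwards, from uniform convergence, which does not
    distinguish the parity of time. In the recursion for the rate, [rho(n) / 2] plays the part of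
    the frequency of discrepancies at a site after [n] steps, [rho(2m)] bounds the effect of
    discrepancies on the remaining steps, and the volume counts the sites. Two small factors against
    a polynomial volume are what allows the box to grow with time. *)

Section locality.
Context {d : nat}.
Implicit Types (sigma eta tau : config d) (Lambda : {fset site d}).

(** The value type is arbitrary so that events, as functions into [Prop], are covered as well. *)
Definition depends_on (T : Type) Lambda (f : config d -> T) : Prop :=
  forall sigma eta, (forall k, k \in Lambda -> sigma k = eta k) ->
    f sigma = f eta.

Definition restr Lambda sigma : {ffun Lambda -> bool} :=
  [ffun i => sigma (val i)].

Definition cylinder Lambda sigma : set (config d) :=
  [set eta | forall k, k \in Lambda -> eta k = sigma k].

Lemma patch_in Lambda (zeta : {ffun Lambda -> bool}) tau k
  (kL : k \in Lambda) : patch zeta tau k = zeta [` kL]%fset.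
Proof. by rewrite /patch insubT. Qed.

Lemma patch_val Lambda (zeta : {ffun Lambda -> bool}) tau (i : Lambda) :
  patch zeta tau (val i) = zeta i.
Proof. by rewrite /patch valK. Qed.

Lemma patch_out Lambda (zeta : {ffun Lambda -> bool}) tau k :
  k \notin Lambda -> patch zeta tau k = tau k.
Proof. by move=> kL; rewrite /patch insubN. Qed.

Lemma patch_restr_in Lambda sigma tau k :
  k \in Lambda -> patch (restr Lambda sigma) tau k = sigma k.
Proof. by move=> kL; rewrite patch_in ffunE. Qed.

Lemma restr_patch Lambda (zeta : {ffun Lambda -> bool}) tau :
  restr Lambda (patch zeta tau) = zeta.
Proof. by apply/ffunP => i; rewrite ffunE patch_val. Qed.

Lemma eq_restr Lambda sigma eta :
  (forall k, k \in Lambda -> sigma k = eta k) ->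
  restr Lambda sigma = restr Lambda eta.
Proof. by move=> e; apply/ffunP => i; rewrite !ffunE e//; exact: fsvalP. Qed.

Lemma depends_on_patch T Lambda (f : config d -> T) sigma tau :
  depends_on Lambda f -> f (patch (restr Lambda sigma) tau) = f sigma.
Proof. by move=> fL; apply: fL => k kL; rewrite patch_restr_in. Qed.

Lemma depends_on_patch2 T Lambda (f : config d -> T)
    (zeta : {ffun Lambda -> bool}) sigma tau :
  depends_on Lambda f -> f (patch zeta sigma) = f (patch zeta tau).
Proof. by move=> fL; apply: fL => k kL; rewrite !patch_in. Qed.

Lemma depends_onW T Lambda Gamma (f : config d -> T) :
  {subset Lambda <= Gamma} -> depends_on Lambda f -> depends_on Gamma f.
Proof. by move=> LG fL s t st; apply: fL => k /LG; exact: st. Qed.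

Lemma depends_on_comp T U Lambda (f : config d -> T) (g : T -> U) :
  depends_on Lambda f -> depends_on Lambda (g \o f).
Proof. by move=> fL s t /fL /= ->. Qed.

Lemma cylinderE Lambda sigma eta :
  cylinder Lambda sigma eta <-> restr Lambda eta = restr Lambda sigma.
Proof.
split=> [|e k kL]; first exact: eq_restr.
by have /ffunP/(_ [` kL]%fset) := e; rewrite !ffunE.
Qed.

Lemma depends_on_cylinder Lambda sigma : depends_on Lambda (cylinder Lambda sigma).
Proof.
by move=> s t /eq_restr e; apply/propext; rewrite !cylinderE e.
Qed.

Lemma measurable_cylinder (D : set (site d)) Lambda sigma :
  [set` Lambda] `<=` D ->
  measurable (cylinder Lambda sigma : set (config_on D)).
Proof.
move=> LD.
rewrite (_ : cylinder _ _ = \bigcap_(k in [set` Lambda]) [set eta | eta k = sigma k]) //.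
apply: fin_bigcap_measurable => // k kL.
by apply: sub_sigma_algebra; exists k, (sigma k); split => //; exact: LD.
Qed.

(** The event is the finite union of the cylinders over its patterns on [Lambda]. A general [D] is
    allowed because the Gibbs property asks for measurability with respect to the spins outside a
    box. *)
Lemma measurable_depends_on (D : set (site d)) Lambda (A : set (config d)) :
  [set` Lambda] `<=` D -> depends_on Lambda A ->
  measurable (A : set (config_on D)).
Proof.
move=> LD AL; pose tau := (const_config true : config d).
rewrite (_ : A = \bigcup_(zeta in [set zeta : {ffun Lambda -> bool} |
    A (patch zeta tau)]) cylinder Lambda (patch zeta tau)).
  by apply: fin_bigcup_measurable => // zeta _; exact: measurable_cylinder.
apply/seteqP; split=> [sigma As|sigma [zeta /= Az /cylinderE e]].
  exists (restr Lambda sigma) => /=; first by rewrite (depends_on_patch _ _ AL).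
  by apply/cylinderE; rewrite restr_patch.
by rewrite -(depends_on_patch sigma tau AL) e restr_patch.
Qed.

Lemma measurable_fun_depends_on (D : set (site d)) Lambda d' (T : measurableType d')
    (f : config d -> T) :
  [set` Lambda] `<=` D -> depends_on Lambda f ->
  measurable_fun [set: config_on D] f.
Proof.
move=> LD fL _ Y mY; rewrite setTI; apply: (measurable_depends_on LD).
exact: (depends_on_comp Y fL).
Qed.

Lemma measurable_local (R : realType) Lambda (f : config d -> R) :
  depends_on Lambda f -> measurable_fun [set: config d] f.
Proof. by move=> fL; exact: (@measurable_fun_depends_on setT Lambda). Qed.

End locality.

Section spin_sums.
Context {R : realType} {d : nat}.
Implicit Types (sigma eta tau : config d) (Lambda Gamma : {fset site d}).
Implicit Types F f g : config d -> R.

Definition spin_sum Lambda F tau : R :=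
  \sum_(zeta : {ffun Lambda -> bool}) F (patch zeta tau).

Lemma depends_on_bounded Lambda f : depends_on Lambda f ->
  exists2 M, 0 < M & forall sigma, `|f sigma| <= M.
Proof.
move=> fL; pose tau := (const_config true : config d).
exists (1 + \sum_(zeta : {ffun Lambda -> bool}) `|f (patch zeta tau)|).
  by rewrite ltr_wpDr// sumr_ge0.
move=> sigma; rewrite -(depends_on_patch sigma tau fL) ler_wpDl//.
by rewrite (bigD1 (restr Lambda sigma))//= ler_wpDr// sumr_ge0.
Qed.

Lemma depends_on_sum_cylinder Lambda f tau sigma : depends_on Lambda f ->
  f sigma = \sum_(zeta : {ffun Lambda -> bool})
    f (patch zeta tau) * \1_(cylinder Lambda (patch zeta tau)) sigma.
Proof.
move=> fL; rewrite (bigD1 (restr Lambda sigma))//= big1 => [|zeta ne].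
  rewrite addr0 indicE mem_set ?mulr1; first by rewrite depends_on_patch.
  by apply/cylinderE; rewrite restr_patch.
rewrite indicE memNset ?mulr0// => /cylinderE; rewrite restr_patch => e.
by rewrite e eqxx in ne.
Qed.

Section expectation.
Variables (m : {measure set (config d) -> \bar R}).
Hypothesis m1 : m [set: config d] = 1%E.
Local Notation E f := (\int[m]_sigma f sigma)%R.

Lemma fin_num_measure1 (A : set (config d)) : measurable A -> m A \is a fin_num.
Proof.
move=> mA; rewrite ge0_fin_numE//; apply: (@le_lt_trans _ _ (m setT)).
  by apply: le_measure; rewrite ?inE.
by rewrite m1 ltry.
Qed.

(** A local function is a finite combination of cylinder indicators. The measure is merely of mass
    one, which covers the values [P eta] of a kernel. *)
Lemma Rintegral_local Lambda f tau : depends_on Lambda f ->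
  E f = \sum_(zeta : {ffun Lambda -> bool})
          f (patch zeta tau) * fine (m (cylinder Lambda (patch zeta tau))).
Proof.
move=> fL.
have mcyl s : measurable (cylinder Lambda s : set (config d)).
  exact: (@measurable_cylinder d setT).
have int1 (zeta : {ffun Lambda -> bool}) : m.-integrable setT
    (EFin \o \1_(cylinder Lambda (patch zeta tau)) : config d -> \bar R).
  apply: (measurable_bounded_integrable measurableT).
  - by rewrite m1 ltry.
  - apply: measurable_indic; exact: mcyl.
  - exists 1; split => // x x1 y _; apply: le_trans (ltW x1).
    by rewrite ger0_norm indicE// lern1 leq_b1.
pose h (zeta : {ffun Lambda -> bool}) sigma : \bar R :=
  ((f (patch zeta tau))%:E * (\1_(cylinder Lambda (patch zeta tau)) sigma)%:E)%E.
have int_h zeta : m.-integrable setT (h zeta).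
  by apply: (integrableZl measurableT); exact: int1.
have hE zeta : (\int[m]_s h zeta s =
    (f (patch zeta tau) * fine (m (cylinder Lambda (patch zeta tau))))%:E)%E.
  rewrite EFinM fineK; last exact: fin_num_measure1.
  rewrite /h (integralZl measurableT (int1 zeta)) /=.
  by rewrite integral_indic// setIT.
rewrite /Rintegral (eq_integral (fun s => \sum_zeta h zeta s)%E) => [|s _].
  by rewrite integral_sum// (eq_bigr _ (fun zeta _ => hE zeta)) sumEFin.
by rewrite (depends_on_sum_cylinder tau s fL) -sumEFin; apply: eq_bigr.
Qed.

End expectation.
End spin_sums.

Section local_functions.
Context {R : realType} {d : nat}.
Implicit Types (sigma eta tau : config d) (Lambda Gamma : {fset site d}).
Implicit Types f g : config d -> R.

Lemma local_fun_common f g : local_fun f -> local_fun g ->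
  exists Lambda, depends_on Lambda f /\ depends_on Lambda g.
Proof.
move=> [L fL] [M gM]; exists (L `|` M)%fset; split.
  by apply: depends_onW fL => k kL; rewrite in_fsetU kL.
by apply: depends_onW gM => k kM; rewrite in_fsetU kM orbT.
Qed.

Lemma local_fun2 (op : R -> R -> R) f g : local_fun f -> local_fun g ->
  local_fun (fun sigma => op (f sigma) (g sigma)).
Proof.
move=> lf lg; have [L [fL gL]] := local_fun_common lf lg.
by exists L => s t st; rewrite (fL s t st) (gL s t st).
Qed.

Lemma local_funD f g : local_fun f -> local_fun g ->
  local_fun (fun sigma => f sigma + g sigma).
Proof. exact: local_fun2. Qed.

Lemma local_funM f g : local_fun f -> local_fun g ->
  local_fun (fun sigma => f sigma * g sigma).
Proof. exact: local_fun2. Qed.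

Lemma local_fun_comp (h : R -> R) f : local_fun f ->
  local_fun (fun sigma => h (f sigma)).
Proof. by move=> lf; exact: (local_fun2 (fun x _ => h x) lf lf). Qed.

Lemma local_fun_cst (c : R) : local_fun (fun _ : config d => c).
Proof. by exists fset0. Qed.

Lemma local_funZ (c : R) f : local_fun f -> local_fun (fun sigma => c * f sigma).
Proof. exact: (@local_fun_comp (fun x => c * x)). Qed.

Lemma local_fun_sum I (r : seq I) (F : I -> config d -> R) :
  (forall i, local_fun (F i)) -> local_fun (fun sigma => \sum_(i <- r) F i sigma).
Proof.
move=> lF; elim: r => [|i r [L IH]]; first by exists fset0 => *; rewrite !big_nil.
rewrite (_ : (fun _ => _) = fun s => F i s + \sum_(j <- r) F j s); last first.
  by apply/funext => s; rewrite big_cons.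
by apply: local_funD => //; exists L.
Qed.

Lemma local_fun_prod I (r : seq I) (F : I -> config d -> R) :
  (forall i, local_fun (F i)) -> local_fun (fun sigma => \prod_(i <- r) F i sigma).
Proof.
move=> lF; elim: r => [|i r [L IH]]; first by exists fset0 => *; rewrite !big_nil.
rewrite (_ : (fun _ => _) = fun s => F i s * \prod_(j <- r) F j s); last first.
  by apply/funext => s; rewrite big_cons.
by apply: local_funM => //; exists L.
Qed.

Lemma local_fun_bounded f : local_fun f ->
  exists2 M, 0 < M & forall sigma, `|f sigma| <= M.
Proof. by case=> L; exact: depends_on_bounded. Qed.

Lemma local_fun_lower f : local_fun f -> (forall sigma, 0 < f sigma) ->
  exists2 e, 0 < e & forall sigma, e <= f sigma.
Proof.
move=> lf f_gt0; have [M M0 fM] := local_fun_bounded (local_fun_comp GRing.inv lf).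
exists M^-1; first by rewrite invr_gt0.
move=> s; rewrite -[leRHS]invrK lef_pV2 ?posrE ?invr_gt0//.
by rewrite (le_trans (ler_norm _)).
Qed.

Lemma local_fun_spin (k : site d) : local_fun (fun sigma => spin (sigma k) : R).
Proof.
by exists [fset k]%fset => s t st; rewrite st// inE.
Qed.

Section expectation.
Variables (m : {measure set (config d) -> \bar R}).
Hypothesis m1 : m [set: config d] = 1%E.
Local Notation E f := (\int[m]_sigma f sigma)%R.

Let tau0 : config d := const_config true.

Lemma expectationD f g : local_fun f -> local_fun g ->
  E (fun sigma => f sigma + g sigma) = E f + E g.
Proof.
move=> lf lg; have [L [fL gL]] := local_fun_common lf lg.
rewrite !(@Rintegral_local _ _ _ m1 L _ tau0)//; last first.
  by move=> s t st; rewrite (fL s t st) (gL s t st).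
by rewrite -big_split; apply: eq_bigr => zeta _; rewrite mulrDl.
Qed.

Lemma expectationZ c f : local_fun f ->
  E (fun sigma => c * f sigma) = c * E f.
Proof.
move=> [L fL]; rewrite !(@Rintegral_local _ _ _ m1 L _ tau0)//; last first.
  by move=> s t st; rewrite (fL s t st).
by rewrite mulr_sumr; apply: eq_bigr => zeta _; rewrite mulrA.
Qed.

Lemma expectation_cst c : E (fun=> c) = c.
Proof. by rewrite Rintegral_cst// m1 mulr1. Qed.

Lemma expectationB f g : local_fun f -> local_fun g ->
  E (fun sigma => f sigma - g sigma) = E f - E g.
Proof.
move=> lf lg; rewrite -[in RHS]mulN1r -expectationZ// -expectationD//.
  by congr Rintegral; apply/funext => s; rewrite mulN1r.
exact: local_funZ.
Qed.

Lemma expectation_sum I (r : seq I) (F : I -> config d -> R) :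
  (forall i, local_fun (F i)) ->
  E (fun sigma => \sum_(i <- r) F i sigma) = \sum_(i <- r) E (F i).
Proof.
move=> lF; elim: r => [|i r IH].
  rewrite big_nil -[RHS]expectation_cst; congr Rintegral.
  by apply/funext => s; rewrite big_nil.
rewrite big_cons -IH -expectationD//; last exact: local_fun_sum.
by congr Rintegral; apply/funext => s; rewrite big_cons.
Qed.

Lemma le_expectation f g : local_fun f -> local_fun g ->
  (forall sigma, f sigma <= g sigma) -> E f <= E g.
Proof.
move=> lf lg fg; have [L [fL gL]] := local_fun_common lf lg.
rewrite !(@Rintegral_local _ _ _ m1 L _ tau0)//; apply: ler_sum => zeta _.
by rewrite ler_wpM2r// fine_ge0.
Qed.

Lemma expectation_cylinder Lambda tau :
  E (fun sigma => \1_(cylinder Lambda tau) sigma) = fine (m (cylinder Lambda tau)).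
Proof.
rewrite /Rintegral; congr fine; rewrite integral_indic ?setIT//.
exact: (@measurable_cylinder _ setT).
Qed.

End expectation.

Lemma depends_on_indic Lambda (A : set (config d)) : depends_on Lambda A ->
  depends_on Lambda (\1_A : config d -> R).
Proof. by move=> AL s t st; rewrite !indicE /in_mem /= /in_set /mem_set /= (AL s t st). Qed.

End local_functions.

(** * The kernel acting on local functions *)

Section local_kernels.
Context {R : realType} {d : nat}.
Variables (p : site d -> bool -> config d -> R).
Variable (P : R.-pker config d ~> config d).
Hypothesis p_local : forall k s, local_fun (p k s).
Hypothesis P_pca : pca_dynamics p P.
Implicit Types (sigma eta tau : config d) (Lambda Gamma : {fset site d}).
Implicit Types (f g : config d -> R) (nu : probability (config d) R).
Local Notation T := (kernel_op P).

Lemma kernel1 eta : P eta [set: config d] = 1%E.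
Proof. exact: prob_kernel. Qed.

Lemma kernel_cylinder eta Lambda tau :
  fine (P eta (cylinder Lambda tau)) = \prod_(k <- Lambda) p k (tau k) eta.
Proof. by rewrite P_pca. Qed.

Lemma kernel_opE f Lambda tau eta : depends_on Lambda f ->
  T f eta = \sum_(zeta : {ffun Lambda -> bool}) f (patch zeta tau) *
    \prod_(k <- Lambda) p k (patch zeta tau k) eta.
Proof.
move=> fL; rewrite /kernel_op (Rintegral_local (kernel1 eta) tau fL).
by apply: eq_bigr => zeta _; rewrite kernel_cylinder.
Qed.

Lemma depends_on_kernel_op f Lambda Gamma : depends_on Lambda f ->
  (forall k s, k \in Lambda -> depends_on Gamma (p k s)) ->
  depends_on Gamma (T f).
Proof.
move=> fL pG s t st; pose tau : config d := const_config true.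
rewrite !(kernel_opE tau _ fL); apply: eq_bigr => zeta _; congr (_ * _).
by apply: eq_big_seq => k kL; apply: pG.
Qed.

Lemma local_kernel_op f : local_fun f -> local_fun (T f).
Proof.
move=> [L fL]; pose tau : config d := const_config true.
rewrite (_ : T f = fun eta => \sum_(zeta : {ffun L -> bool})
   f (patch zeta tau) * \prod_(k <- L) p k (patch zeta tau k) eta).
  by apply: local_fun_sum => zeta; apply: local_funZ; exact: local_fun_prod.
by apply/funext => eta; exact: kernel_opE.
Qed.

Lemma local_iter n f : local_fun f -> local_fun (iter n T f).
Proof. by move=> lf; elim: n => //= n; exact: local_kernel_op. Qed.

Lemma kernel_opD f g : local_fun f -> local_fun g ->
  T (fun sigma => f sigma + g sigma) = fun sigma => T f sigma + T g sigma.
Proof. by move=> lf lg; apply/funext => s; exact: (expectationD (kernel1 s)). Qed.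

Lemma kernel_opZ c f : local_fun f ->
  T (fun sigma => c * f sigma) = fun sigma => c * T f sigma.
Proof. by move=> lf; apply/funext => s; exact: (expectationZ (kernel1 s)). Qed.

Lemma kernel_op_cst c : T (fun=> c) = fun=> c.
Proof. by apply/funext => s; exact: (expectation_cst (kernel1 s)). Qed.

Lemma le_kernel_op f g : local_fun f -> local_fun g ->
  (forall sigma, f sigma <= g sigma) -> forall sigma, T f sigma <= T g sigma.
Proof. by move=> lf lg fg s; exact: (le_expectation (kernel1 s)). Qed.

Lemma iter_opD n f g : local_fun f -> local_fun g ->
  iter n T (fun sigma => f sigma + g sigma) =
  fun sigma => iter n T f sigma + iter n T g sigma.
Proof.
by move=> lf lg; elim: n => //= n ->; rewrite kernel_opD//; exact: local_iter.
Qed.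

Lemma iter_opZ n c f : local_fun f ->
  iter n T (fun sigma => c * f sigma) = fun sigma => c * iter n T f sigma.
Proof. by move=> lf; elim: n => //= n ->; rewrite kernel_opZ//; exact: local_iter. Qed.

Lemma iter_op_cst n c : iter n T (fun=> c) = fun=> c.
Proof. by elim: n => //= n ->; exact: kernel_op_cst. Qed.

Lemma le_iter_op n f g : local_fun f -> local_fun g ->
  (forall sigma, f sigma <= g sigma) ->
  forall sigma, iter n T f sigma <= iter n T g sigma.
Proof.
move=> lf lg fg; elim: n => //= n IH.
by apply: le_kernel_op => //; exact: local_iter.
Qed.

Lemma iter_op_sum n I (r : seq I) (F : I -> config d -> R) :
  (forall i, local_fun (F i)) ->
  iter n T (fun sigma => \sum_(i <- r) F i sigma) =
  fun sigma => \sum_(i <- r) iter n T (F i) sigma.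
Proof.
move=> lF; elim: r => [|i r IH].
  rewrite [X in iter n T X](_ : _ = fun=> 0); last first.
    by apply/funext => s; rewrite big_nil.
  by rewrite iter_op_cst; apply/funext => s; rewrite big_nil.
rewrite [X in iter n T X](_ : _ = fun s => F i s + \sum_(j <- r) F j s).
  rewrite iter_opD ?IH//; last exact: local_fun_sum.
  by apply/funext => s; rewrite big_cons.
by apply/funext => s; rewrite big_cons.
Qed.

(** Duality of measures and functions: on cylinders it is the definition of [step], and both sides
    are finite combinations of cylinder terms. *)
Lemma expectation_step nu f : local_fun f ->
  (\int[step P nu]_sigma f sigma = \int[nu]_sigma T f sigma)%R.
Proof.
move=> [L fL]; pose tau : config d := const_config true.
rewrite (Rintegral_local (probability_setT (step P nu)) tau fL).
under [in RHS]eq_Rintegral do rewrite (kernel_opE tau _ fL).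
rewrite (expectation_sum (probability_setT nu)) => [|zeta]; last first.
  by apply: local_funZ; exact: local_fun_prod.
apply: eq_bigr => zeta _; rewrite (expectationZ (probability_setT nu)); last first.
  exact: local_fun_prod.
congr (_ * _); rewrite /Rintegral; congr fine; apply: eq_integral => s _.
exact: P_pca.
Qed.

Lemma expectation_evolve nu n f : local_fun f ->
  (\int[evolve P nu n]_sigma f sigma = \int[nu]_sigma iter n T f sigma)%R.
Proof.
move=> lf; elim: n f lf => //= n IH f lf.
by rewrite expectation_step// IH -?iterSr//; exact: local_kernel_op.
Qed.

End local_kernels.

(** * Detailed balance *)

Section hyperbolic_lemmas.
Context {R : realType}.
Implicit Types x : R.

Lemma cosh_gt0 x : 0 < cosh x.
Proof. by rewrite divr_gt0// addr_gt0// expR_gt0. Qed.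

(** The exponential form of the rule: its numerator is a factor of the joint weight of two
    consecutive configurations. *)
Lemma half_tanh (s : bool) x :
  2^-1 * (1 + spin s * tanh x) = expR (spin s * x) / (2 * cosh x).
Proof.
rewrite /tanh /cosh mulrC -[2 * (_ / _)]mulrCA divff ?pnatr_eq0// mulr1.
have h : expR x + expR (- x) != 0 by rewrite gt_eqF// addr_gt0// expR_gt0.
by case: s; rewrite /spin ?mul1r ?mulN1r; field.
Qed.

End hyperbolic_lemmas.

Section ising.
Context {R : realType} {d : nat}.
Variables (beta : R) (K : site d -> R).
Hypothesis K_sym : forall k : site d, K (- k) = K k.
Hypothesis K_fin : finite_set [set k | K k != 0].
Variable P : R.-pker config d ~> config d.
Hypothesis P_pca : pca_dynamics (pca_rule beta K) P.
Implicit Types (sigma eta tau : config d) (Lambda Gamma : {fset site d}).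
Implicit Types (f g : config d -> R) (j k : site d).
Local Notation T := (kernel_op P).
Local Notation phi := (pca_potential beta K).

Definition K_supp : {fset site d} := fset_set [set k | K k != 0].

Definition nbhd_fset k : {fset site d} := [fset k - j | j in K_supp]%fset.

(** By symmetry of [K] these are the sites whose neighbourhood meets [Lambda]. They index the energy
    terms that see [Lambda], and they are also the sites on which [T f] depends when [f] depends on
    [Lambda]. *)
Definition nbhds Lambda : {fset site d} :=
  \big[fsetU/fset0]_(j <- Lambda) nbhd_fset j.

Definition field k sigma : R :=
  beta * \sum_(j \in [set: site d]) K (k - j) * spin (sigma j).

Lemma in_K_supp k : (k \in K_supp) = (K k != 0).
Proof. by rewrite in_fset_set//; apply/idP/idP; rewrite inE. Qed.

Lemma in_nbhd_fset k j : (j \in nbhd_fset k) = (K (k - j) != 0).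
Proof.
apply/imfsetP/idP => [[i /= iK ->]|Kj]; first by rewrite subKr -in_K_supp.
by exists (k - j); rewrite ?subKr//= in_K_supp.
Qed.

Lemma nbhdE k : nbhd K k = [set` nbhd_fset k].
Proof. by apply/seteqP; split=> j /=; rewrite in_nbhd_fset. Qed.

Lemma Kdist j k : K (j - k) = K (k - j).
Proof. by rewrite -K_sym opprB. Qed.

Lemma in_nbhds Lambda k :
  (k \in nbhds Lambda) <-> (exists2 j, j \in Lambda & K (k - j) != 0).
Proof.
rewrite /nbhds; split.
  move/bigfcupP => [j]; rewrite andbT => jL; rewrite in_nbhd_fset Kdist => Kjk.
  by exists j.
move=> [j jL Kjk]; apply/bigfcupP; exists j; rewrite ?andbT//.
by rewrite in_nbhd_fset Kdist.
Qed.

Lemma fieldE k sigma (D : {fset site d}) :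
  (forall j, j \notin D -> K (k - j) = 0) ->
  field k sigma = beta * \sum_(j <- D) K (k - j) * spin (sigma j).
Proof.
move=> KD; rewrite /field (@fsbigTE _ _ _ _ D)// => j /KD ->.
by rewrite mul0r.
Qed.

Lemma depends_on_field k : depends_on (nbhd_fset k) (field k).
Proof.
have KD j : j \notin nbhd_fset k -> K (k - j) = 0.
  by rewrite in_nbhd_fset negbK => /eqP.
move=> s t st; rewrite !(fieldE _ KD); congr (_ * _).
by apply: eq_big_seq => j jD; rewrite st.
Qed.

Lemma pca_ruleE k s eta :
  pca_rule beta K k s eta = expR (spin s * field k eta) / (2 * cosh (field k eta)).
Proof.
rewrite -half_tanh /pca_rule /field; congr (_ * (1 + _ * tanh (_ * _))).
by apply: eq_fsbigr => j _; rewrite Kdist.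
Qed.

Lemma depends_on_pca_rule k s : depends_on (nbhd_fset k) (pca_rule beta K k s).
Proof. by move=> t u tu; rewrite !pca_ruleE (depends_on_field tu). Qed.

Lemma pca_rule_local k s : local_fun (pca_rule beta K k s).
Proof. by exists (nbhd_fset k); exact: depends_on_pca_rule. Qed.

Lemma pca_rule_gt0 k s eta : 0 < pca_rule beta K k s eta.
Proof. by rewrite pca_ruleE divr_gt0 ?expR_gt0// mulr_gt0// cosh_gt0. Qed.

Lemma depends_on_nbhds f Lambda : depends_on Lambda f ->
  depends_on (nbhds Lambda) (T f).
Proof.
move=> fL; apply: (depends_on_kernel_op P_pca fL) => k s kL.
apply: depends_onW (@depends_on_pca_rule k s) => j jk.
by apply/in_nbhds; exists k => //; rewrite Kdist -in_nbhd_fset.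
Qed.

Definition weight Lambda sigma : R := \prod_(k <- nbhds Lambda) cosh (field k sigma).

Lemma weight_gt0 Lambda sigma : 0 < weight Lambda sigma.
Proof. by apply: prodr_gt0 => k _; exact: cosh_gt0. Qed.

(** The sites of [nbhd_fset k] sum to [k] times the cardinality of [K_supp], minus a constant. This
    determines [k], since membership in [nbhds Lambda] provides a nonzero coupling. *)
Lemma nbhd_fset_inj Lambda : {in nbhds Lambda &, injective nbhd_fset}.
Proof.
move=> k l /in_nbhds[j _ Kkj] _ kl.
have sumE i : \sum_(x <- nbhd_fset i) x = i *+ #|` K_supp| - \sum_(s <- K_supp) s.
  rewrite big_imfset/=; last by move=> x y _ _ /addrI/oppr_inj.
  by rewrite sumrB big_const_seq count_predT iter_addr_0.
have := sumE k; rewrite kl sumE => /addIr lk.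
have S0 : (0 < #|` K_supp|)%N.
  by rewrite cardfs_gt0; apply/fset0Pn; exists (k - j); rewrite in_K_supp.
apply/esym/rowP => i; apply/eqP; have /rowP/(_ i)/eqP := lk.
by rewrite !mulmxnE -subr_eq0 -mulrnBl mulrn_eq0 eqn0Ngt S0 subr_eq0.
Qed.

Lemma hamiltonianE Lambda sigma :
  hamiltonian phi Lambda sigma =
  \sum_(k <- nbhds Lambda) local_energy beta K k sigma.
Proof.
rewrite /hamiltonian [RHS](fsbig_seq _ _ (fset_uniq _)).
have in_img A (k : site d) : (A `&` Lambda)%fset != fset0 -> nbhd K k = [set` A] ->
    k \in nbhds Lambda /\ A = nbhd_fset k.
  move=> AL kA; have AE : A = nbhd_fset k.
    apply/fsetP => j; rewrite in_nbhd_fset; apply/idP/idP => jA.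
      by have : nbhd K k j by rewrite kA.
    by have : [set` A] j by rewrite -kA.
  split=> //; have /fset0Pn[j] := AL; rewrite AE inE in_nbhd_fset => /andP[Kkj jL].
  by apply/in_nbhds; exists j.
(* The other sets meeting [Lambda] carry no energy, so the sum reduces to the image of
   [nbhds Lambda] and can be reindexed by sites. *)
rewrite -(@fsbig_widen _ _ _ _ (nbhd_fset @` [set` nbhds Lambda])); last 2 first.
- move=> _ [k /= kV <-] /=; have /in_nbhds[j jL Kkj] := kV.
  by apply/fset0Pn; exists j; rewrite inE in_nbhd_fset Kkj.
- move=> A [/= AL nA]; rewrite /pca_potential; case: pselect => // ek.
  exfalso; case: ek => k kA; have [kV AE] := in_img _ _ AL kA.
  by apply: nA; exists k.
rewrite fsbig_image; last first.
  by move=> x y /set_mem xV /set_mem yV; exact: (@nbhd_fset_inj Lambda).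
by apply: eq_fsbigr => k _; apply: pca_potential_nbhd; exact: nbhdE.
Qed.

Lemma boltzmannE Lambda tau (zeta : {ffun Lambda -> bool}) :
  boltzmann phi tau zeta = weight Lambda (patch zeta tau).
Proof.
rewrite /boltzmann hamiltonianE -sumrN /weight expR_sum.
by apply: eq_bigr => k _; rewrite /local_energy opprK lnK// posrE cosh_gt0.
Qed.

Lemma partition_fun_gt0 Lambda tau : 0 < partition_fun phi Lambda tau.
Proof.
rewrite /partition_fun (bigD1 (restr Lambda tau))//= ltr_wpDr//.
  by apply: sumr_ge0 => zeta _; exact: expR_ge0.
exact: expR_gt0.
Qed.

Lemma gibbs_fin_gt0 Lambda tau (zeta : {ffun Lambda -> bool}) :
  0 < gibbs_fin phi tau zeta.
Proof. by rewrite divr_gt0 ?partition_fun_gt0// expR_gt0. Qed.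

Lemma gibbs_fin_intE Lambda tau f :
  gibbs_fin_int phi Lambda tau f =
  spin_sum Lambda (fun s => f s * weight Lambda s) tau /
  spin_sum Lambda (weight Lambda) tau.
Proof.
rewrite /gibbs_fin_int /gibbs_fin /partition_fun /spin_sum.
under eq_bigr do rewrite mulrA.
rewrite -mulr_suml; congr (_ / _); apply: eq_bigr => zeta _;
  by rewrite boltzmannE.
Qed.

(** The joint weight of two consecutive configurations, with [eta] read on [nbhds Lambda]. The
    factor 1/2 per site makes the sum over [eta] equal to [weight Lambda sigma]. *)
Definition coupling Lambda sigma eta : R :=
  \prod_(k <- nbhds Lambda) (expR (spin (eta k) * field k sigma) / 2).

Lemma weight_kernel_op Lambda g sigma tau : depends_on (nbhds Lambda) g ->
  weight Lambda sigma * T g sigma =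
  spin_sum (nbhds Lambda) (fun eta => g eta * coupling Lambda sigma eta) tau.
Proof.
move=> gV; rewrite (kernel_opE P_pca tau sigma gV) mulr_sumr.
apply: eq_bigr => zeta _; rewrite mulrCA -big_split/=; congr (_ * _).
apply: eq_bigr => k _; rewrite pca_ruleE; have := cosh_gt0 (field k sigma).
by move=> /lt0r_neq0 ?; field.
Qed.

Lemma sum_coupling Lambda sigma tau :
  spin_sum (nbhds Lambda) (coupling Lambda sigma) tau = weight Lambda sigma.
Proof.
rewrite -[RHS]mulr1 -[X in _ * X](_ : T (fun=> 1) sigma = 1); last first.
  by rewrite kernel_op_cst.
by rewrite (@weight_kernel_op _ _ _ tau)//; apply: eq_bigr => zeta _; rewrite mul1r.
Qed.

(* For fixed [eta] the coupling is, as a function of the spins in [Lambda],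
   proportional to the product of the laws [pca_rule beta K j _ eta]. *)
Lemma coupling_product Lambda eta tau :
  exists C : R, forall zeta : {ffun Lambda -> bool},
    coupling Lambda (patch zeta tau) eta =
    C * \prod_(j <- Lambda) pca_rule beta K j (patch zeta tau j) eta.
Proof.
pose V := nbhds Lambda.
(* [D] contains every site seen by a field at a site of [V]; [c] is the part of the exponent due to
   the boundary spins [tau], the same for all [zeta]. *)
pose D := (Lambda `|` \big[fsetU/fset0]_(k <- V) nbhd_fset k)%fset.
pose c := \sum_(k <- V) spin (eta k) *
  (beta * \sum_(j <- (D `\` Lambda)%fset) K (k - j) * spin (tau j)).
have KD k j : k \in V -> j \notin D -> K (k - j) = 0.
  move=> kV; rewrite in_fsetU negb_or => /andP[_ jU].
  apply/eqP; apply: contraNT jU; rewrite -in_nbhd_fset => jk.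
  by apply/bigfcupP; exists k; rewrite ?kV.
have KV j k : j \in Lambda -> k \notin V -> K (j - k) = 0.
  move=> jL kV; apply/eqP; apply: contraNT kV => Kjk.
  by apply/in_nbhds; exists j; rewrite // Kdist.
have energyE (zeta : {ffun Lambda -> bool}) : let sigma := patch zeta tau in
    \sum_(k <- V) spin (eta k) * field k sigma =
    c + \sum_(j <- Lambda) spin (sigma j) * field j eta.
  move=> sigma.
  transitivity (\sum_(k <- V) (spin (eta k) *
      (beta * \sum_(j <- (D `\` Lambda)%fset) K (k - j) * spin (tau j)) +
    \sum_(j <- Lambda) beta * K (k - j) * spin (eta k) * spin (sigma j))).
    apply: eq_big_seq => k kV; rewrite (@fieldE k sigma D) => [|j]; last exact: KD.
    rewrite (big_fsetID _ (fun j => j \in Lambda))/= [X in _ * X]mulrDr mulrDr addrC.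
    congr (_ + _).
      congr (_ * (_ * _)).
      rewrite (_ : [fset x | x in D & x \notin Lambda]%fset = (D `\` Lambda)%fset).
        by apply: eq_big_seq => j; rewrite in_fsetD => /andP[jL _]; rewrite /sigma patch_out.
      by apply/fsetP => j; rewrite !inE andbC.
    rewrite (_ : [fset x | x in D & x \in Lambda]%fset = Lambda).
      by rewrite !mulr_sumr; apply: eq_bigr => j _; ring.
    by apply/fsetP => j; rewrite !inE andbC; case: (j \in Lambda).
  rewrite big_split; congr (_ + _); rewrite exchange_big.
  apply: eq_big_seq => j jL; rewrite (@fieldE j eta V) => [|k]; last exact: KV.
  by rewrite !mulr_sumr; apply: eq_bigr => k _; rewrite (Kdist j); ring.
exists (expR c * (\prod_(k <- V) 2^-1) *
  \prod_(j <- Lambda) (2 * cosh (field j eta))) => zeta.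
rewrite /coupling big_split/= -expR_sum energyE expRD -/V mulrAC -[in RHS]mulrA.
congr (_ * _); rewrite expR_sum -big_split/=.
apply: eq_bigr => j _; rewrite pca_ruleE; have := cosh_gt0 (field j eta).
by move=> /lt0r_neq0 ?; field.
Qed.

(** The unknown constant of [coupling_product] is eliminated by comparing [f] with the constant
    function 1. *)
Lemma coupling_kernel_op Lambda f eta tau : depends_on Lambda f ->
  spin_sum Lambda (fun sigma => f sigma * coupling Lambda sigma eta) tau =
  T f eta * spin_sum Lambda (fun sigma => coupling Lambda sigma eta) tau.
Proof.
move=> fL; have [C CE] := coupling_product Lambda eta tau.
have sumE g : depends_on Lambda g ->
    spin_sum Lambda (fun sigma => g sigma * coupling Lambda sigma eta) tau =
    C * T g eta.
  move=> gL; rewrite (kernel_opE P_pca tau eta gL) mulr_sumr.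
  by apply: eq_bigr => zeta _; rewrite CE mulrCA.
rewrite sumE// mulrC; congr (_ * _).
have := sumE (fun=> 1); rewrite kernel_op_cst mulr1 => <-//.
by apply: eq_bigr => zeta _; rewrite mul1r.
Qed.

(* Detailed balance in finite volume: the joint weight [coupling] of two
   consecutive configurations is a product law in either of them. *)
Lemma gibbs_fin_int_kernel2 Lambda tau f : depends_on Lambda f ->
  gibbs_fin_int phi Lambda tau (T (T f)) = gibbs_fin_int phi Lambda tau f.
Proof.
move=> fL; rewrite !gibbs_fin_intE; congr (_ / _).
have TfV := depends_on_nbhds fL.
(* Pivot: resolving the inner sum over [sigma] yields two applications of [T], while summing [eta]
   out first yields [f] times the weight. *)
transitivity (spin_sum (nbhds Lambda) (fun eta => spin_sum Lambda
    (fun sigma => f sigma * coupling Lambda sigma eta) tau) tau).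
  rewrite /spin_sum.
  under eq_bigr => zeta _ do rewrite mulrC (weight_kernel_op _ tau TfV).
  rewrite exchange_big; apply: eq_bigr => xi _ /=.
  by rewrite -mulr_sumr -(coupling_kernel_op _ tau fL).
rewrite /spin_sum exchange_big; apply: eq_bigr => zeta _ /=.
by rewrite -mulr_sumr; congr (_ * _); exact: sum_coupling.
Qed.

End ising.

(** * Local events as a generating pi-system *)

Section local_sets.
Context {d : nat}.
Implicit Types (Lambda Gamma : {fset site d}).

Definition local_sets (D : set (site d)) : set (set (config d)) :=
  [set A | exists2 Lambda : {fset site d}, [set` Lambda] `<=` D & depends_on Lambda A].

Lemma local_setsI D : setI_closed (local_sets D).
Proof.
move=> A B [L LD AL] [M MD BM]; exists (L `|` M)%fset.
  by move=> k /=; rewrite in_fsetU => /orP[/LD|/MD].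
move=> s t st; rewrite /setI; congr (_ /\ _).
  by apply: AL => k kL; apply: st; rewrite in_fsetU kL.
by apply: BM => k kM; apply: st; rewrite in_fsetU kM orbT.
Qed.

Lemma measurable_local_sets (D : set (site d)) :
  @measurable _ (config_on D) = <<s local_sets D >>.
Proof.
apply/seteqP; split.
  apply: smallest_sub; first exact: smallest_sigma_algebra.
  move=> _ [k [s [Dk ->]]]; apply: sub_sigma_algebra.
  exists [fset k]%fset; first by move=> j /=; rewrite inE => /eqP ->.
  by move=> t u tu /=; rewrite (tu k)// inE.
apply: smallest_sub; first exact: (@sigma_algebra_measurable _ (config_on D)).
by move=> A [L LD AL]; exact: measurable_depends_on AL.
Qed.

End local_sets.

(** Local events form a pi-system generating the sigma-algebra, and their indicators are local
    functions. *)
Lemma measure_eq_local (R : realType) (d : nat) (mu nu : probability (config d) R) :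
  (forall f : config d -> R, local_fun f ->
    (\int[mu]_sigma f sigma = \int[nu]_sigma f sigma)%R) ->
  measure_eq mu nu.
Proof.
move=> mn A mA; apply: (measure_unique (local_sets [set: site d]) (fun=> setT)) => //.
- exact: (measurable_local_sets setT).
- exact: local_setsI.
- by move=> _; exists fset0.
- exact: bigcup_const.
- move=> B [L _ BL].
  have mB : measurable (B : set (config d)) by apply: (@measurable_depends_on _ setT L).
  have := mn _ (ex_intro _ L (@depends_on_indic R _ _ _ BL)).
  rewrite /Rintegral !integral_indic// !setIT => e.
  by rewrite -[LHS]fineK ?fin_num_measure// e fineK// fin_num_measure.
- by move=> _; rewrite [ltLHS](probability_setT mu) ltry.
Qed.

(** * The Gibbs specification *)

Section flips.
Context {R : realType} {d : nat}.
Implicit Types (sigma eta tau : config d) (Lambda Gamma : {fset site d}).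

(** Flips permute the patterns of any larger box. Written with flips, an inner sum over [Lambda] is
    absorbed by the sum over the larger box without splitting its patterns in two. *)
Definition flip Lambda (xi : {ffun Lambda -> bool}) sigma : config d :=
  fun k => sigma k (+) (if insub k is Some i then xi i else false).

Lemma spin_sum_flip Lambda Gamma (xi : {ffun Lambda -> bool}) (F : config d -> R) tau :
  (Lambda `<=` Gamma)%fset ->
  spin_sum Gamma (F \o flip xi) tau = spin_sum Gamma F tau.
Proof.
move=> LG; pose h (zeta : {ffun Gamma -> bool}) : {ffun Gamma -> bool} :=
  restr Gamma (flip xi (patch zeta tau)).
have hE zeta : patch (h zeta) tau = flip xi (patch zeta tau).
  apply/funext => k; have [kG|kG] := boolP (k \in Gamma).
    by rewrite /h patch_restr_in.
  rewrite patch_out// /flip patch_out// insubN ?addbF//.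
  by apply: contra kG; exact: (fsubsetP LG).
have hK : involutive h.
  move=> zeta; apply/ffunP => i; rewrite /h ffunE {1}/flip hE /flip -addbA.
  by case: insub => [j|]; rewrite ?addbb !addbF patch_val.
rewrite /spin_sum [RHS](reindex_inj (inv_inj hK)); apply: eq_bigr => zeta _ /=.
by rewrite hE.
Qed.

Lemma spin_sumE_flip Lambda (F : config d -> R) sigma :
  spin_sum Lambda F sigma = \sum_(xi : {ffun Lambda -> bool}) F (flip xi sigma).
Proof.
pose h (xi : {ffun Lambda -> bool}) := restr Lambda (flip xi sigma).
have hE xi : patch (h xi) sigma = flip xi sigma.
  apply/funext => k; have [kL|kL] := boolP (k \in Lambda).
    by rewrite /h patch_restr_in.
  by rewrite patch_out// /flip insubN// addbF.
have hK : involutive h.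
  move=> xi; apply/ffunP => i; rewrite /h ffunE /flip valK ffunE /flip valK.
  by rewrite addbA addbb.
rewrite /spin_sum (reindex_inj (inv_inj hK)); apply: eq_bigr => xi _.
by rewrite hE.
Qed.

Lemma spin_sum2 Lambda Gamma (F : config d -> R) tau : (Lambda `<=` Gamma)%fset ->
  spin_sum Gamma (spin_sum Lambda F) tau =
  spin_sum Gamma F tau *+ #|{ffun Lambda -> bool}|.
Proof.
move=> LG; rewrite {1}/spin_sum.
under eq_bigr do rewrite spin_sumE_flip.
rewrite exchange_big/= -sumr_const; apply: eq_bigr => xi _.
exact: (spin_sum_flip xi F tau LG).
Qed.

End flips.

(** * Consistency and the DLR equations *)

Section specification.
Context {R : realType} {d : nat}.
Variables (beta : R) (K : site d -> R).
Hypothesis K_sym : forall k : site d, K (- k) = K k.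
Hypothesis K_fin : finite_set [set k | K k != 0].
Implicit Types (sigma eta tau : config d) (Lambda Gamma : {fset site d}).
Implicit Types (f g : config d -> R) (j k : site d).
Local Notation phi := (pca_potential beta K).
Local Notation gfi := (gibbs_fin_int phi).
Local Notation nbhds := (nbhds K).
Local Notation weight := (weight beta K).
Local Notation field := (field beta K).

Lemma sum_gibbs_fin Lambda tau :
  \sum_(zeta : {ffun Lambda -> bool}) gibbs_fin phi tau zeta = 1.
Proof.
rewrite /gibbs_fin -mulr_suml divff// gt_eqF//.
exact: partition_fun_gt0.
Qed.

Lemma gibbs_fin_int_cst Lambda tau c : gfi Lambda tau (fun=> c) = c.
Proof. by rewrite /gibbs_fin_int -mulr_sumr sum_gibbs_fin mulr1. Qed.

Lemma gibbs_fin_intD Lambda tau f g :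
  gfi Lambda tau (fun s => f s + g s) = gfi Lambda tau f + gfi Lambda tau g.
Proof. by rewrite -big_split; apply: eq_bigr => zeta _; rewrite mulrDl. Qed.

Lemma gibbs_fin_intZ Lambda tau c f :
  gfi Lambda tau (fun s => c * f s) = c * gfi Lambda tau f.
Proof. by rewrite mulr_sumr; apply: eq_bigr => zeta _; rewrite mulrA. Qed.

Lemma le_gibbs_fin_int Lambda tau f g :
  (forall zeta : {ffun Lambda -> bool}, f (patch zeta tau) <= g (patch zeta tau)) ->
  gfi Lambda tau f <= gfi Lambda tau g.
Proof.
move=> fg; apply: ler_sum => zeta _; rewrite ler_wpM2r//.
by apply: ltW; exact: gibbs_fin_gt0.
Qed.

Lemma eq_gibbs_fin_int Lambda tau f g :
  (forall zeta : {ffun Lambda -> bool}, f (patch zeta tau) = g (patch zeta tau)) ->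
  gfi Lambda tau f = gfi Lambda tau g.
Proof. by move=> fg; apply: eq_bigr => zeta _; rewrite fg. Qed.

Lemma depends_on_weight Lambda :
  depends_on (\big[fsetU/fset0]_(k <- nbhds Lambda) nbhd_fset K k)%fset (weight Lambda).
Proof.
move=> s t st; apply: eq_big_seq => k kV; congr cosh.
apply: (depends_on_field beta K_fin) => j jk; apply: st.
by apply/bigfcupP; exists k; rewrite ?kV.
Qed.

(** [patch] overwrites the boundary condition inside [Lambda], and only finitely many other spins
    enter the weight. *)
Lemma gibbs_fin_outside Lambda : exists2 Gamma : {fset site d},
  [set` Gamma] `<=` ~` [set` Lambda] &
  forall zeta : {ffun Lambda -> bool},
    depends_on Gamma (fun tau => gibbs_fin phi tau zeta).
Proof.
pose D := (\big[fsetU/fset0]_(k <- nbhds Lambda) nbhd_fset K k)%fset.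
exists (D `\` Lambda)%fset; first by move=> k /=; rewrite in_fsetD => /andP[/negP].
move=> zeta s t st.
have bE (xi : {ffun Lambda -> bool}) : boltzmann phi s xi = boltzmann phi t xi :> R.
  rewrite !(boltzmannE beta K_sym K_fin); apply: depends_on_weight => k kD.
  have [kL|kL] := boolP (k \in Lambda); first by rewrite !(patch_in _ _ kL).
  by rewrite !patch_out// st// in_fsetD kL.
by rewrite /gibbs_fin /partition_fun bE; under eq_bigr do rewrite bE.
Qed.

Lemma local_gibbs_fin Lambda (zeta : {ffun Lambda -> bool}) :
  local_fun (fun tau => gibbs_fin phi tau zeta).
Proof. have [G _ zG] := gibbs_fin_outside Lambda; exists G; exact: (zG zeta). Qed.

Lemma depends_on_patchl T Lambda Gamma (zeta : {ffun Lambda -> bool})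
    (f : config d -> T) :
  depends_on Gamma f -> depends_on Gamma (fun tau => f (patch zeta tau)).
Proof.
move=> fG s t st; apply: fG => k kG; have [kL|kL] := boolP (k \in Lambda).
  by rewrite !(patch_in _ _ kL).
by rewrite !patch_out// st.
Qed.

Lemma local_gibbs_fin_int Lambda f : local_fun f ->
  local_fun (fun tau => gfi Lambda tau f).
Proof.
move=> [L fL]; apply: local_fun_sum => zeta; apply: local_funM.
  by exists L; exact: depends_on_patchl.
exact: local_gibbs_fin.
Qed.

Lemma patch_patch Lambda (zeta xi : {ffun Lambda -> bool}) tau :
  patch zeta (patch xi tau) = patch zeta tau.
Proof. by apply/funext => k; rewrite /patch; case: insub. Qed.

Lemma gibbs_fin_patch Lambda (zeta xi : {ffun Lambda -> bool}) tau :
  gibbs_fin phi (patch xi tau) zeta = gibbs_fin phi tau zeta.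
Proof.
have bE (zeta' : {ffun Lambda -> bool}) :
    boltzmann phi (patch xi tau) zeta' = boltzmann phi tau zeta' :> R.
  by rewrite /boltzmann (patch_patch zeta' xi tau).
exact: (congr2 (fun a b => a / b) (bE zeta) (eq_bigr _ (fun z _ => bE z))).
Qed.

Lemma gibbs_fin_int_patch Lambda (xi : {ffun Lambda -> bool}) tau f :
  gfi Lambda (patch xi tau) f = gfi Lambda tau f.
Proof.
by apply: eq_bigr => zeta _; rewrite (patch_patch zeta xi tau) gibbs_fin_patch.
Qed.

(** A factor at a site whose neighbourhood misses [Lambda] does not see the spins there, so it
    cancels in the conditional law. *)
Lemma weight_subset Lambda Gamma : (Lambda `<=` Gamma)%fset ->
  exists2 rest : config d -> R,
    forall sigma, weight Gamma sigma = weight Lambda sigma * rest sigma &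
    forall (zeta : {ffun Lambda -> bool}) sigma, rest (patch zeta sigma) = rest sigma.
Proof.
move=> LG; exists (fun s => \prod_(k <- (nbhds Gamma `\` nbhds Lambda)%fset)
    cosh (field k s)).
  move=> s; rewrite /weight (big_fsetID _ (fun j => j \in nbhds Lambda))/=.
  congr (_ * _); apply: eq_fbigl => k; rewrite !inE/=; last by rewrite andbC.
  apply/andP/idP => [[]//|kL]; split=> //.
  have [j jL Kkj] := (in_nbhds K_sym K_fin _ _).1 kL.
  by apply/(in_nbhds K_sym K_fin); exists j => //; exact: (fsubsetP LG).
move=> zeta s; apply: eq_big_seq => k; rewrite in_fsetD => /andP[kL _].
congr cosh; apply: (depends_on_field beta K_fin) => j.
rewrite in_nbhd_fset// => Kkj; rewrite patch_out//; apply: contra kL => jL.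
by apply/(in_nbhds K_sym K_fin); exists j.
Qed.

Lemma gibbs_fin_int_consistent Lambda Gamma tau f : (Lambda `<=` Gamma)%fset ->
  gfi Gamma tau (fun sigma => gfi Lambda sigma f) = gfi Gamma tau f.
Proof.
move=> LG; rewrite !(gibbs_fin_intE beta K_sym K_fin Gamma); congr (_ / _).
have [rest wE restE] := weight_subset LG.
have N0 : (0 < #|{ffun Lambda -> bool}|)%N.
  by apply/card_gt0P; exists [ffun=> true].
(* Multiplied by the number of patterns on [Lambda], both numerators become double sums whose inner
   sums over [Lambda] agree for each outer configuration. *)
apply: (mulIf (lt0r_neq0 (_ : 0 < #|{ffun Lambda -> bool}|%:R))); first by rewrite ltr0n.
rewrite !mulr_natr -!spin_sum2//; apply: eq_bigr => zeta _.
move: (patch zeta tau) => sigma; rewrite /spin_sum.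
under eq_bigr => xi _ do rewrite gibbs_fin_int_patch wE restE mulrA.
under [RHS]eq_bigr => xi _ do rewrite wE restE mulrA.
rewrite -!mulr_suml -mulr_sumr; congr (_ * _).
rewrite (gibbs_fin_intE beta K_sym K_fin) /spin_sum divfK// gt_eqF//.
rewrite (bigD1 (restr Lambda sigma))//= ltr_wpDr ?weight_gt0//.
by apply: sumr_ge0 => xi _; apply: ltW; exact: weight_gt0.
Qed.

Section dlr.
Variable mu : probability (config d) R.
Local Notation E f := (\int[mu]_sigma f sigma)%R.

Lemma gibbs_expectation Lambda f : gibbs phi mu -> depends_on Lambda f ->
  E f = E (fun tau => gfi Lambda tau f).
Proof.
move=> mu_gibbs fL; pose tau0 : config d := const_config true.
have mu1 := probability_setT mu.
rewrite (Rintegral_local mu1 tau0 fL).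
rewrite (_ : (fun tau => gfi Lambda tau f) = fun tau =>
    \sum_(zeta : {ffun Lambda -> bool}) f (patch zeta tau0) * gibbs_fin phi tau zeta).
  rewrite (expectation_sum mu1) => [|zeta]; last first.
    by apply: local_funZ; exact: local_gibbs_fin.
  apply: eq_bigr => zeta _; rewrite (expectationZ mu1); last exact: local_gibbs_fin.
  congr (_ * _); have [_ /(_ setT measurableT)] := mu_gibbs Lambda zeta.
  rewrite setIT /Rintegral => <-; congr (fine (mu _)).
  apply/seteqP; split=> s /= h => [i|k kL].
    by rewrite -(patch_val zeta tau0) h// fsvalP.
  by rewrite patch_in (h [` kL]%fset).
apply/funext => tau; apply: eq_bigr => zeta _; congr (_ * _).
exact: depends_on_patch2.
Qed.

(** For a local event [B] outside [Lambda] the hypothesis is applied to the indicator of the pattern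
    event intersected with [B]; the pi-lambda theorem then reaches all events outside [Lambda]. *)
Lemma gibbs_of_expectation :
  (forall Lambda f, local_fun f -> E (fun tau => gfi Lambda tau f) = E f) ->
  gibbs phi mu.
Proof.
move=> dlr Lambda zeta; pose D := ~` [set` Lambda].
have [G GD zG] := gibbs_fin_outside Lambda.
split; first exact: (measurable_fun_depends_on GD (zG zeta)).
pose g tau : \bar R := (gibbs_fin phi tau zeta)%:E.
have g0 tau : (0 <= g tau)%E by rewrite lee_fin ltW// gibbs_fin_gt0.
have mg A : measurable_fun A g.
  apply: (@measurable_funTS _ _ (config d)); apply/measurable_EFinP.
  exact: (measurable_local (zG zeta)).
pose C := [set sigma : config d | forall i : Lambda, sigma (val i) = zeta i].
have CE : C = cylinder Lambda (patch zeta (const_config true)).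
  apply/seteqP; split=> s /= h => [k kL|i].
    by rewrite patch_in (h [` kL]%fset).
  by rewrite h ?patch_val// fsvalP.
have mC : measurable (C : set (config d)).
  by rewrite CE; exact: (@measurable_cylinder _ setT).
have mD B : measurable (B : set (config_on D)) -> measurable (B : set (config d)).
  apply: smallest_sub => [|A [k [s [_ ->]]]].
    exact: (@sigma_algebra_measurable _ (config d)).
  by apply: sub_sigma_algebra; exists k, s.
pose Q B := mu (C `&` B) = (\int[mu]_(tau in B) g tau)%E.
have QL B : local_sets D B -> Q B.
  move=> [L LD BL].
  have mB : measurable (B : set (config d)) by apply: (@measurable_depends_on _ setT L).
  have lCB : local_fun (\1_(C `&` B) : config d -> R).
    exists (Lambda `|` L)%fset; apply: depends_on_indic => s t st.
    rewrite /setI; congr (_ /\ _); last by apply: BL => k kL; rewrite st// in_fsetU kL orbT.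
    by rewrite CE; apply: depends_on_cylinder => k kL; rewrite st// in_fsetU kL.
  have := dlr Lambda _ lCB.
  rewrite (_ : (fun tau => gfi Lambda tau _) = fun tau => \1_B tau * gibbs_fin phi tau zeta).
    move=> e.
    have E1 : (\int[mu]_(tau in B) g tau = \int[mu]_tau (\1_B tau * gibbs_fin phi tau zeta)%:E)%E.
      rewrite integral_mkcond; apply: eq_integral => tau _.
      by rewrite patchE indicE; case: ifP => _; rewrite ?mul1r ?mul0r.
    have fin : (\int[mu]_tau (\1_B tau * gibbs_fin phi tau zeta)%:E)%E \is a fin_num.
      have lg : local_fun (fun tau => \1_B tau * gibbs_fin phi tau zeta).
        apply: local_funM; last exact: local_gibbs_fin.
        by exists L; exact: depends_on_indic.
      have [M M0 gM] := local_fun_bounded lg; have [L' gL'] := lg.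
      apply: (@integrable_fin_num _ _ _ mu setT measurableT).
      apply: (measurable_bounded_integrable measurableT).
      - by rewrite [ltLHS](probability_setT mu) ltry.
      - exact: (measurable_local gL').
      - by exists M; split; [exact: num_real|move=> x Mx t _ /=; exact: le_trans (gM t) (ltW Mx)].
    rewrite /Q E1 -(fineK fin); move: e; rewrite /Rintegral => ->.
    rewrite integral_indic ?setIT//; last exact: measurableI.
    by rewrite fineK// fin_num_measure//; exact: measurableI.
  apply/funext => tau; rewrite /gibbs_fin_int (bigD1 zeta)//= big1 => [|xi xz].
    rewrite addr0 indicI /= [\1_C _](_ : _ = 1) ?mul1r.
      congr (_ * _); apply: (depends_on_indic BL) => k /LD kL.
      by rewrite patch_out//; exact/negP.
    by rewrite indicE mem_set// => i; rewrite patch_val.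
  rewrite indicI /= [\1_C _](_ : _ = 0) ?mul0r//.
  rewrite indicE memNset// => Cxi; move/eqP: xz; apply; apply/ffunP => i.
  by rewrite -(Cxi i) patch_val.
move=> B mB; apply: (@dynkin_induction _ (config_on D) (local_sets D) Q).
- exact: measurable_local_sets.
- exact: local_setsI.
- by apply: QL; exists fset0.
- exact: QL.
(* Adding the finite contribution of [S] to both sides reduces the complement to the whole space. *)
- move=> S /mD mS QS; have QT : Q setT by apply: QL; exists fset0.
  have fS : mu (C `&` S) \is a fin_num by rewrite fin_num_measure//; exact: measurableI.
  have mCS : measurable (~` S : set (config d)) by exact: measurableC.
  rewrite /Q -[LHS](addeK _ fS) -[RHS](addeK _ fS); congr (_ - _)%E.
  rewrite [in RHS]QS -ge0_integral_setU//; last by apply/disj_setPCr.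
  rewrite -measureU.
  + by rewrite -setIUr setvU.
  + exact: measurableI.
  + exact: measurableI.
  + by rewrite setIACA setICl setI0.
- move=> F mF tF QF.
  have mCF n : measurable (C `&` F n : set (config d)).
    by apply: measurableI => //; exact: mD.
  rewrite /Q setI_bigcupr measure_semi_bigcup//; last 2 first.
  + exact: trivIset_setIl.
  + exact: bigcupT_measurable.
  rewrite ge0_integral_bigcup//; last by move=> n; exact: mD.
  by apply: eq_eseriesr => n _; exact: QF.
- by rewrite -measurable_local_sets.
Qed.

End dlr.
End specification.

(** * Measures from positive functionals *)

Section compactness.
Context {d : nat}.
Implicit Types (Lambda Gamma : {fset site d}).

(** Compactness of the configuration space: the ultrafilter decides each spin, and finite
    intersections handle finitely many spins at once. *)
Lemma ultra_config (U : set_system nat) (s_ : nat -> config d) :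
  UltraFilter U -> exists sigma : config d, forall Lambda,
    U [set n | forall k, k \in Lambda -> s_ n k = sigma k].
Proof.
move=> UU; exists (fun k => `[< U [set n | s_ n k] >]) => Lambda.
rewrite (_ : [set n | _] = \bigcap_(k in [set` Lambda])
  [set n | s_ n k = `[< U [set n | s_ n k] >]]) //.
apply: filter_bigI => k _; have [Uk|nUk] := asboolP (U [set n | s_ n k]).
  exact: Uk.
have [//|] := in_ultra_setVsetC [set n | s_ n k] UU.
by apply: filterS => n /= /negP/negbTE.
Qed.

Lemma local_sets_compact (A : nat -> set (config d)) :
  (forall n, local_sets setT (A n)) -> (forall n, A n !=set0) ->
  (forall m n, (m <= n)%N -> A n `<=` A m) -> exists sigma, forall n, A n sigma.
Proof.
move=> lA /choice[s_ As] dA.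
have [U [UU Uoo]] := ultraFilterLemma (@eventually_filter).
have [sigma sE] := ultra_config s_ UU; exists sigma => m.
have [L _ AL] := lA m.
have : U ([set n | forall k, k \in L -> s_ n k = sigma k] `&` [set n | (m <= n)%N]).
  by apply: filterI; [exact: sE|apply: Uoo; exists m].
move/filter_ex => [n [/= sn mn]].
by rewrite -(AL _ _ sn); exact: dA (As n).
Qed.

End compactness.

(** A copy of [config d] that carries the algebra of local events instead of the sigma-algebra, as
    the starting point of the extension theorem. *)
Definition local_config (d : nat) := config d.

Section local_algebra.
Context {d : nat}.

Lemma local_sets0 : local_sets [set: site d] set0.
Proof. by exists fset0. Qed.

Lemma local_setsC : setC_closed (local_sets [set: site d]).
Proof.
by move=> A [L LD AL]; exists L => // s t st; rewrite /setC/= /mkset (AL s t st).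
Qed.

Lemma local_setsU : setU_closed (local_sets [set: site d]).
Proof.
move=> A B lA lB; rewrite -(setCK A) -(setCK B) -setCI.
by apply: local_setsC; apply: local_setsI; exact: local_setsC.
Qed.

HB.instance Definition _ := Pointed.on (local_config d).
HB.instance Definition _ := @isAlgebraOfSets.Build default_measure_display
  (local_config d) (local_sets setT) local_sets0 local_setsU local_setsC.

End local_algebra.

Section local_functional.
Context {R : realType} {d : nat}.
Variable l : (config d -> R) -> R.
Hypothesis lD : forall f g, local_fun f -> local_fun g ->
  l (fun s => f s + g s) = l f + l g.
Hypothesis lZ : forall c f, local_fun f -> l (fun s => c * f s) = c * l f.
Hypothesis l_ge0 : forall f, local_fun f -> (forall s, 0 <= f s) -> 0 <= l f.
Hypothesis l1 : l (fun=> 1) = 1.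

(* The absolute value only matters on the junk values at nonlocal sets. *)
Definition local_content (A : set (local_config d)) : \bar R :=
  `|l (\1_A : config d -> R)|%:E.

Let local_indic A : local_sets setT A -> local_fun (\1_A : config d -> R).
Proof. by move=> [L _ AL]; exists L; exact: depends_on_indic. Qed.

Lemma local_contentE A : local_sets setT A ->
  local_content A = (l (\1_A : config d -> R))%:E.
Proof.
by move=> /local_indic lA; rewrite /local_content ger0_norm//; exact: l_ge0.
Qed.

Let content0 : local_content set0 = 0%E.
Proof.
rewrite /local_content indic0; have := lZ 0 (local_fun_cst 0).
rewrite (_ : (fun _ => _) = cst 0); last by apply/funext => s; rewrite mul0r.
by rewrite mul0r => ->; rewrite normr0.
Qed.

Let content_ge0 A : (0 <= local_content A)%E.
Proof. by rewrite lee_fin. Qed.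

Let contentU A B : local_sets setT A -> local_sets setT B -> A `&` B = set0 ->
  (local_content (A `|` B) = local_content A + local_content B)%E.
Proof.
move=> lA lB AB; rewrite !local_contentE//; last exact: local_setsU.
rewrite -EFinD -lD; [|exact: local_indic|exact: local_indic].
congr (l _)%:E; apply/funext => s; rewrite !indicE in_setU.
have [sA|] := boolP (s \in A); have [sB|] := boolP (s \in B); rewrite ?addr0 ?add0r//.
by move: sA sB; rewrite !inE => sA sB; have : (A `&` B) s by []; rewrite AB.
Qed.

(** By compactness, a countable union of local events that is itself local is already a finite
    union, so the partial sums are eventually constant. *)
Let content_sigma_additive : semi_sigma_additive local_content.
Proof.
move=> F lF tF lUF.
pose B n := \big[setU/set0]_(i < n) F i.
have lB n : local_sets setT (B n).
  by apply: big_ind => [||i _]; [exact: local_sets0|exact: local_setsU|exact: lF].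
have sumE n : (\sum_(0 <= i < n) local_content (F i) = local_content (B n))%E.
  rewrite big_mkord; elim: n => [|n IH]; first by rewrite /B !big_ord0 content0.
  rewrite big_ord_recr/= IH /B big_ord_recr/= contentU//.
  - exact: lB.
  - exact: lF.
  - by apply: (@trivIset_bigsetUI _ predT) => //; rewrite /predT /= trueE.
have [N FN] : exists N, forall n, (N <= n)%N -> B n = \bigcup_n F n.
  have BF n : B n `<=` \bigcup_n F n by exact: bigsetU_bigcup.
  apply: contrapT => /forallNP nB.
  have [] := @local_sets_compact d (fun n => (\bigcup_n F n) `\` B n).
  - by move=> n; rewrite setDE; apply: local_setsI => //; exact: local_setsC.
  - move=> N; apply: contrapT => /nonemptyPn; rewrite setD_eq0 => FB.
    apply: (nB N) => n Nn; apply/seteqP; split; first exact: BF.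
    by apply: (subset_trans FB); exact: subset_bigsetU.
  - by move=> m n mn; apply: setDS; exact: subset_bigsetU.
  move=> s sF; have [[i _ Fis] _] := sF 0%N; have [_] := sF i.+1.
  by apply; rewrite /B big_ord_recr/=; right.
apply: cvg_near_cst; exists N => // n /= Nn.
by rewrite sumE FN.
Qed.

HB.instance Definition _ := isMeasure.Build default_measure_display
  (local_config d) R local_content content0 content_ge0 content_sigma_additive.

Definition extension (A : set (config d)) : \bar R := measure_extension local_content A.

Let extension_local A : local_sets setT A -> extension A = local_content A.
Proof. by move=> lA; rewrite /extension /measure_extension measurable_mu_extE. Qed.

Let extension0 : extension set0 = 0%E.
Proof. exact: measure0. Qed.

Let extension_ge0 A : (0 <= extension A)%E.
Proof. exact: measure_ge0. Qed.

Let extension_sigma_additive : semi_sigma_additive extension.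
Proof.
have mE : (@measurable _ (config d)) = <<s local_sets [set: site d] >>.
  exact: (measurable_local_sets setT).
move=> F mF tF mUF.
apply: (@measure_semi_sigma_additive _ _ _ (measure_extension local_content)) => //.
- by move=> i; have := mF i; rewrite mE.
- by move: mUF; rewrite mE.
Qed.

HB.instance Definition _ := isMeasure.Build _ (config d) R extension
  extension0 extension_ge0 extension_sigma_additive.

Let extensionT : extension [set: config d] = 1%E.
Proof.
rewrite extension_local; last by exists fset0.
rewrite local_contentE; last by exists fset0.
by rewrite indicT l1.
Qed.

HB.instance Definition _ := Measure_isProbability.Build _ _ _ extension extensionT.

(** A Riesz representation on local functions, by Caratheodory extension. It turns a limit of finite
    volume expectations into a measure. *)
Lemma functional_extension : exists mu : probability (config d) R,
  forall f, local_fun f -> (\int[mu]_sigma f sigma)%R = l f.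
Proof.
exists extension => f [L fL]; pose tau : config d := const_config true.
rewrite (Rintegral_local extensionT tau fL).
have lsum (I : finType) (F : I -> config d -> R) : (forall i, local_fun (F i)) ->
    l (fun s => \sum_i F i s) = \sum_i l (F i).
  move=> lF; elim: (index_enum I) => [|i r IH].
    rewrite big_nil -[RHS](mul0r (l (fun=> 1))) -lZ; last exact: local_fun_cst.
    by congr l; apply/funext => s; rewrite big_nil mul0r.
  rewrite big_cons -IH -lD//; last exact: local_fun_sum.
  by congr l; apply/funext => s; rewrite big_cons.
have lcyl s : local_sets setT (cylinder L s).
  by exists L => //; exact: depends_on_cylinder.
transitivity (l (fun s => \sum_(zeta : {ffun L -> bool})
    f (patch zeta tau) * \1_(cylinder L (patch zeta tau)) s)).
  rewrite lsum => [|zeta]; last by apply: local_funZ; exact: local_indic.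
  apply: eq_bigr => zeta _; rewrite lZ; last exact: local_indic.
  congr (_ * _); have := extension_local (lcyl (patch zeta tau)).
  rewrite local_contentE// => e; exact: (congr1 fine e).
by congr l; apply/funext => s; rewrite -(depends_on_sum_cylinder tau s fL).
Qed.

End local_functional.

(** * Monotone comparison with finite volumes *)

Section decomposition.
Context {R : realType} {d : nat}.
Implicit Types (sigma eta : config d) (Lambda : {fset site d}) (f : config d -> R).

(** A spin jumps by 2, so the factor 1/2 makes a switch at a site [k] of [Lambda] worth exactly
    [D k]. *)
Definition half_spins Lambda (D : site d -> R) sigma : R :=
  \sum_(k <- Lambda) D k / 2 * spin (sigma k).

Lemma local_half_spins Lambda D : local_fun (half_spins Lambda D).
Proof. by apply: local_fun_sum => k; apply: local_funZ; exact: local_fun_spin. Qed.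

(** The spins in [Lambda] are switched from [sigma] to [eta] one at a time; a switch changes [f] by
    at most [D k], which is what [half_spins] gains. *)
Lemma lipschitz_half_spins Lambda (D : site d -> R) f sigma eta :
  depends_on Lambda f -> (forall k, 0 <= D k) ->
  (forall k s t, (forall j, j != k -> s j = t j) -> `|f s - f t| <= D k) ->
  (forall k, sigma k ==> eta k) ->
  `|f eta - f sigma| <= half_spins Lambda D eta - half_spins Lambda D sigma.
Proof.
move=> fL D0 fD se; pose hyb (r : seq (site d)) : config d :=
  fun k => if k \in r then eta k else sigma k.
have spin_le k : 0 <= (spin (eta k) - spin (sigma k) : R).
  by have := se k; rewrite /spin; case: (sigma k); case: (eta k) => //=; lra.
have step r : `|f (hyb r) - f sigma| <=
    \sum_(k <- r) D k / 2 * (spin (eta k) - spin (sigma k)).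
  elim: r => [|k r IH]; first by rewrite big_nil [hyb _](_ : _ = sigma)// subrr normr0.
  rewrite big_cons -(subrKA (f (hyb r))) (le_trans (ler_normD _ _))// lerD//.
  have [skk|skk] := eqVneq (sigma k) (eta k).
    rewrite [hyb (k :: r)](_ : _ = hyb r) ?subrr ?normr0.
      by rewrite mulr_ge0// divr_ge0.
    by apply/funext => j; rewrite /hyb inE; case: eqVneq => //= ->; rewrite skk if_same.
  have -> : D k / 2 * (spin (eta k) - spin (sigma k)) = D k.
    by have := se k; move: skk; rewrite /spin; case: (sigma k); case: (eta k) => //= _ _; field.
  by apply: fD => j jk; rewrite /hyb inE (negbTE jk).
have := step (enum_fset Lambda); rewrite [f (hyb _)](_ : _ = f eta); last first.
  by apply: fL => k kL; rewrite /hyb kL.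
move=> /le_trans; apply; rewrite /half_spins -sumrB; apply: ler_sum => k _.
by rewrite mulrBr.
Qed.

(** Half spins with [D] twice a bound of [f] outgrow any variation of [f]. Every local function is
    thus a difference of two increasing ones. *)
Lemma local_fun_decomposition f : local_fun f -> exists g : config d -> R,
  [/\ local_fun g, coord_increasing g & coord_increasing (fun s => g s + f s)].
Proof.
move=> lf; have [M M0 fM] := local_fun_bounded lf; have [L fL] := lf.
have D0 (k : site d) : 0 <= M + M by rewrite addr_ge0// ltW.
have fD (k : site d) (s t : config d) : (forall j, j != k -> s j = t j) -> `|f s - f t| <= M + M.
  by move=> _; rewrite (le_trans (ler_normB _ _))// lerD.
have fG (s t : config d) (st : forall k, s k ==> t k) := lipschitz_half_spins fL D0 fD st.
exists (half_spins L (fun=> M + M)); split; first exact: local_half_spins.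
- by move=> s t st; rewrite -subr_ge0 (le_trans (normr_ge0 _) (fG s t st)).
- move=> s t st; have := fG s t st; rewrite ler_norml => /andP[h _].
  by rewrite -subr_ge0 opprD addrACA -lerBlDl sub0r.
Qed.

End decomposition.

(** * Comparison of the dynamics with the reset chain *)

Section dynamics.
Context {R : realType} {d : nat}.
Variables (beta : R) (K : site d -> R).
Hypothesis K_sym : forall k : site d, K (- k) = K k.
Hypothesis K_fin : finite_set [set k | K k != 0].
Variable P : R.-pker config d ~> config d.
Hypothesis P_pca : pca_dynamics (pca_rule beta K) P.
Hypothesis P_attr : attractive P.
Implicit Types (sigma eta tau : config d) (Lambda Gamma : {fset site d}).
Implicit Types (f g : config d -> R) (j k : site d) (s : bool).
Local Notation T := (kernel_op P).
Local Notation phi := (pca_potential beta K).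
Local Notation gfi := (gibbs_fin_int phi).

Let p_local := pca_rule_local beta K_sym K_fin.
Let T_local := local_kernel_op p_local P_pca.
Let iter_local := local_iter p_local P_pca.

(** The sign lets one proof serve both boundary conditions: increasing functions are bounded above
    by resets to +1, decreasing ones by resets to -1. *)
Definition monotone_for s f := coord_increasing (fun sigma => spin s * f sigma).

Lemma monotone_forT f : coord_increasing f -> monotone_for true f.
Proof. by move=> fi u v uv; rewrite /spin !mul1r; exact: fi. Qed.

Lemma monotone_forF f : coord_increasing f -> monotone_for false (fun u => - f u).
Proof. by move=> fi u v uv; rewrite /spin !mulN1r !opprK; exact: fi. Qed.

Lemma coord_increasing_kernel_op f : local_fun f ->
  coord_increasing f -> coord_increasing (T f).
Proof. by move=> [L fL]; apply: P_attr; exact: (measurable_local fL). Qed.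

Lemma monotone_kernel_op s f : local_fun f ->
  monotone_for s f -> monotone_for s (T f).
Proof.
rewrite /monotone_for => lf fs; rewrite -(kernel_opZ P (spin s) lf).
by apply: coord_increasing_kernel_op => //; exact: local_funZ.
Qed.

Lemma coord_increasing_iter n f : local_fun f ->
  coord_increasing f -> coord_increasing (iter n T f).
Proof.
move=> lf fi; elim: n => //= n; apply: coord_increasing_kernel_op.
exact: iter_local.
Qed.

Lemma monotone_iter s n f : local_fun f ->
  monotone_for s f -> monotone_for s (iter n T f).
Proof.
move=> lf fi; elim: n => //= n; apply: monotone_kernel_op; exact: iter_local.
Qed.

Definition reset Lambda s sigma : config d :=
  patch (restr Lambda sigma) (const_config s).

Lemma depends_on_reset Lambda s f : depends_on Lambda (fun u => f (reset Lambda s u)).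
Proof. by move=> u v uv; rewrite /reset (eq_restr uv). Qed.

Lemma local_reset Lambda s f : local_fun (fun u => f (reset Lambda s u)).
Proof. by exists Lambda; exact: depends_on_reset. Qed.

Lemma reset_patch Lambda s (zeta : {ffun Lambda -> bool}) :
  reset Lambda s (patch zeta (const_config s)) = patch zeta (const_config s).
Proof. by rewrite /reset restr_patch. Qed.

Lemma coord_increasing_reset Lambda s f : coord_increasing f ->
  coord_increasing (fun u => f (reset Lambda s u)).
Proof.
move=> fi u v uv; apply: fi => k; rewrite /reset.
have [kL|kL] := boolP (k \in Lambda); first by rewrite !patch_restr_in.
by rewrite !patch_out// implybb.
Qed.

Lemma monotone_reset Lambda s f : monotone_for s f ->
  monotone_for s (fun u => f (reset Lambda s u)).
Proof. by move=> fs; exact: (@coord_increasing_reset Lambda s _ fs). Qed.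

Lemma monotone_le_reset Lambda s f sigma : monotone_for s f ->
  f sigma <= f (reset Lambda s sigma).
Proof.
have resetP k : reset Lambda s sigma k = if k \in Lambda then sigma k else s.
  by rewrite /reset; case: ifPn => kL; [exact: patch_restr_in|exact: patch_out].
case: s resetP => resetP fs.
  have := fs sigma (reset Lambda true sigma); rewrite /spin !mul1r => h; apply: h => k.
  by rewrite resetP; case: ifP; rewrite ?implybb ?implybT.
have := fs (reset Lambda false sigma) sigma; rewrite /spin !mulN1r lerN2 => h; apply: h => k.
by rewrite resetP; case: ifP; rewrite ?implybb.
Qed.

(** In time order: two steps of the dynamics, over which the finite volume expectation is preserved,
    and then a reset. *)
Definition reset_op Lambda s f : config d -> R :=
  T (T (fun u => f (reset Lambda s u))).

Lemma local_reset_op Lambda s f : local_fun (reset_op Lambda s f).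
Proof. by do 2!apply: T_local; exact: local_reset. Qed.

Lemma local_iter_reset Lambda s n f : local_fun f ->
  local_fun (iter n (reset_op Lambda s) f).
Proof. by case: n => //= n _; exact: local_reset_op. Qed.

Lemma gibbs_fin_int_reset Lambda s f :
  gfi Lambda (const_config s) (fun u => f (reset Lambda s u)) =
  gfi Lambda (const_config s) f.
Proof. by apply: eq_gibbs_fin_int => zeta; rewrite reset_patch. Qed.

Lemma gibbs_fin_int_iter_reset Lambda s n f :
  gfi Lambda (const_config s) (iter n (reset_op Lambda s) f) =
  gfi Lambda (const_config s) f.
Proof.
elim: n => //= n <-; rewrite /reset_op (gibbs_fin_int_kernel2 K_sym K_fin P_pca).
  exact: gibbs_fin_int_reset.
exact: depends_on_reset.
Qed.

Lemma monotone_iter_le_reset Lambda s n f : local_fun f -> monotone_for s f ->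
  forall sigma, iter n.*2 T f sigma <= iter n (reset_op Lambda s) f sigma.
Proof.
move=> lf fs; elim: n => // n IH sigma; rewrite doubleS /=.
have lQ := local_iter_reset Lambda s n lf.
have mQ : monotone_for s (iter n (reset_op Lambda s) f).
  case: n {IH} lQ => // n lQ; elim: n {lQ} => [|n IH].
    rewrite /= /reset_op; apply: monotone_kernel_op; first exact/T_local/local_reset.
    by apply: monotone_kernel_op; [exact: local_reset|exact: monotone_reset].
  rewrite iterS {1}/reset_op; apply: monotone_kernel_op; first exact/T_local/local_reset.
  by apply: monotone_kernel_op; [exact: local_reset|exact: monotone_reset].
have le1 u : iter n.*2 T f u <= iter n (reset_op Lambda s) f (reset Lambda s u).
  by apply: le_trans (IH u) _; exact: monotone_le_reset.
have le2 := le_kernel_op P (iter_local n.*2 lf) (local_reset _ _ _) le1.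
apply: (le_kernel_op P _ _ le2); apply: T_local; first exact: iter_local.
exact: local_reset.
Qed.

(** Doeblin's argument: from every configuration all spins of [Lambda] become +1 in one step with
    probability at least [delta], and there [g] equals [g tau]. The bound is uniform because this
    probability is a positive local function. *)
Lemma kernel_op_contraction Lambda : exists2 delta : R, 0 < delta <= 1 &
  forall g a b, depends_on Lambda g -> (forall u, a <= g u <= b) ->
  exists a' b', b' - a' <= (1 - delta) * (b - a) /\ forall u, a' <= T g u <= b'.
Proof.
pose tau : config d := const_config true; pose c := cylinder Lambda tau.
have cL : depends_on Lambda (\1_c : config d -> R).
  by apply: depends_on_indic; exact: depends_on_cylinder.
have lc : local_fun (\1_c : config d -> R) by exists Lambda.
have TcE u : T \1_c u = \prod_(k <- Lambda) pca_rule beta K k (tau k) u.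
  rewrite -(kernel_cylinder P_pca); exact: (expectation_cylinder (P u)).
have [delta delta0 Tc_ge] : exists2 delta, 0 < delta & forall u, delta <= T \1_c u.
  apply: local_fun_lower => [|u]; first exact: T_local.
  by rewrite TcE prodr_gt0// => k _; exact: pca_rule_gt0.
have Tc_le u : T \1_c u <= 1.
  have := le_kernel_op P lc (local_fun_cst 1) _ u; rewrite kernel_op_cst; apply => v.
  by rewrite indicE lern1 leq_b1.
exists delta => [|g a b gL gab].
  by rewrite delta0 (le_trans (Tc_ge tau)).
have lg : local_fun g by exists Lambda.
have g_ge u : a + (g tau - a) * \1_c u <= g u.
  rewrite indicE; have [uc|_] := boolP (u \in c).
    by rewrite mulr1 addrC subrK (gL tau u)// => k kL; move/set_mem : uc => ->.
  by rewrite mulr0 addr0; have /andP[] := gab u.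
have g_le u : g u <= b + (g tau - b) * \1_c u.
  rewrite indicE; have [uc|_] := boolP (u \in c).
    by rewrite mulr1 addrC subrK (gL tau u)// => k kL; move/set_mem : uc => ->.
  by rewrite mulr0 addr0; have /andP[] := gab u.
have /andP[ag gb] := gab tau.
have l1c (x y : R) : local_fun (fun v => x + y * \1_c v).
  by apply: local_funD; [exact: local_fun_cst|exact: (local_funZ y lc)].
have T1c (x y : R) u : T (fun v => x + y * \1_c v) u = x + y * T \1_c u.
  rewrite kernel_opD ?kernel_op_cst ?kernel_opZ//; first exact: local_fun_cst.
  exact: (local_funZ y lc).
exists (a + delta * (g tau - a)), (b - delta * (b - g tau)); split; first by lra.
move=> u; apply/andP; split.
  have := le_kernel_op P (l1c _ _) lg g_ge u; rewrite T1c => /(le_trans _); apply.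
  by rewrite lerD2l mulrC ler_wpM2l// subr_ge0.
have := le_kernel_op P lg (l1c _ _) g_le u; rewrite T1c => /le_trans; apply.
by rewrite lerD2l -mulrN opprB mulrC ler_wnM2r// subr_le0.
Qed.

Lemma kernel_op_bounds g a b : local_fun g -> (forall u, a <= g u <= b) ->
  forall u, a <= T g u <= b.
Proof.
move=> lg gab u.
have := le_kernel_op P (local_fun_cst a) lg (fun v => (andP (gab v)).1) u.
have := le_kernel_op P lg (local_fun_cst b) (fun v => (andP (gab v)).2) u.
by rewrite !kernel_op_cst => -> ->.
Qed.

(** The range of the iterates shrinks geometrically and always contains the finite volume
    expectation of [f], which all iterates share. *)
Lemma iter_reset_cvg Lambda s f e : local_fun f -> 0 < e ->
  exists n, forall u,
    `|iter n (reset_op Lambda s) f u - gfi Lambda (const_config s) f| <= e.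
Proof.
move=> lf e0; have [delta /andP[d0 d1] contr] := kernel_op_contraction Lambda.
have [M M0 fM] := local_fun_bounded lf.
have bounds n : exists a b, b - a <= (1 - delta) ^+ n * (M + M) /\
    forall u, a <= iter n (reset_op Lambda s) f u <= b.
  elim: n => [|n [a [b [ab fab]]]].
    exists (- M), M; rewrite expr0 mul1r opprK; split=> // u.
    by rewrite -ler_norml.
  (* The contraction applies to the iterate after the reset, a function of the spins in [Lambda];
     the outer kernel then keeps the bounds. *)
  have fabr u : a <= iter n (reset_op Lambda s) f (reset Lambda s u) <= b by exact: fab.
  have [a' [b' [ab' fab']]] := contr _ a b (@depends_on_reset Lambda s (iter n (reset_op Lambda s) f)) fabr.
  exists a', b'; split.
    apply: le_trans ab' _; rewrite exprS -mulrA ler_wpM2l// subr_ge0//.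
  move=> u; rewrite iterS; apply: kernel_op_bounds => //.
  by apply: T_local; exact: local_reset.
have [n ne] : exists n, (1 - delta) ^+ n * (M + M) <= e.
  have : (1 - delta) ^+ n @[n --> \oo] --> (0 : R).
    by apply: cvg_expr; rewrite ger0_norm; lra.
  move=> /cvgrPdist_le /(_ (e / (M + M))) []; first by rewrite divr_gt0// addr_gt0.
  move=> n _ /(_ n (leqnn n)); rewrite sub0r normrN ger0_norm; last first.
    by rewrite exprn_ge0// subr_ge0.
  by rewrite ler_pdivlMr ?addr_gt0// => ?; exists n.
exists n => u; have [a [b [ab fab]]] := bounds n.
have /andP[au ub] := fab u.
have ga : a <= gfi Lambda (const_config s) f.
  rewrite -(gibbs_fin_int_iter_reset _ _ n) -(gibbs_fin_int_cst beta K Lambda (const_config s) a).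
  by apply: le_gibbs_fin_int => zeta; have /andP[] := fab (patch zeta (const_config s)).
have gb : gfi Lambda (const_config s) f <= b.
  rewrite -(gibbs_fin_int_iter_reset _ _ n) -(gibbs_fin_int_cst beta K Lambda (const_config s) b).
  by apply: le_gibbs_fin_int => zeta; have /andP[] := fab (patch zeta (const_config s)).
apply: le_trans ne; apply: le_trans ab; rewrite ler_norml; lra.
Qed.

(* Resetting the spins outside [Lambda] to [s] every second step dominates the
   dynamics, and the resulting finite chain contracts to its invariant law,
   the finite volume Gibbs measure. *)
Lemma iter_le_gibbs_fin_int Lambda s f e : local_fun f -> monotone_for s f ->
  0 < e -> exists n, forall u,
    iter n.*2 T f u <= gfi Lambda (const_config s) f + e.
Proof.
move=> lf fs e0; have [n ne] := iter_reset_cvg Lambda s lf e0.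
exists n => u; apply: le_trans (monotone_iter_le_reset Lambda n lf fs u) _.
by have := ne u; rewrite ler_norml => /andP[_]; rewrite lerBlDl.
Qed.

Section gibbs_measures.
Variable mu : probability (config d) R.
Hypothesis mu_gibbs : gibbs phi mu.
Local Notation E f := (\int[mu]_sigma f sigma)%R.

(** The box [L] has to carry both [f] and [T (T f)], so that the DLR expectation applies to each of
    them. *)
Lemma gibbs_kernel2 f : local_fun f -> E (T (T f)) = E f.
Proof.
move=> lf; have [L [fL TTfL]] := local_fun_common lf (T_local (T_local lf)).
rewrite (gibbs_expectation K_sym K_fin mu_gibbs fL).
rewrite (gibbs_expectation K_sym K_fin mu_gibbs TTfL).
congr Rintegral; apply/funext => tau.
exact: (gibbs_fin_int_kernel2 K_sym K_fin P_pca).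
Qed.

Lemma gibbs_iter n f : local_fun f -> E (iter n.*2 T f) = E f.
Proof.
move=> lf; elim: n => // n IH.
by rewrite doubleS /= gibbs_kernel2//; exact: iter_local.
Qed.

(** The dynamics takes the place of a correlation inequality: even iterates keep [E f] and end up
    below the finite volume expectation plus any [e]. *)
Lemma gibbs_le_gibbs_fin_int Lambda s f : local_fun f -> monotone_for s f ->
  E f <= gfi Lambda (const_config s) f.
Proof.
move=> lf fs; apply/ler_addgt0Pr => e e0.
have [n ne] := iter_le_gibbs_fin_int Lambda lf fs e0.
rewrite -(gibbs_iter n lf) -(expectation_cst (probability_setT mu) (_ + e)).
apply: (le_expectation (probability_setT mu)) => //; first exact: iter_local.
exact: local_fun_cst.
Qed.

End gibbs_measures.
End dynamics.

(** * Convergence under uniqueness *)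

Lemma ultra_bounded_cvg (R : realType) (U : set_system nat) (v : nat -> R) M :
  UltraFilter U -> (forall n, `|v n| <= M) -> exists x : R, v n @[n --> U] --> x.
Proof.
move=> UU vM.
have UM : (v n @[n --> U]) `[- M, M]%classic.
  apply: (@filterS _ U _ setT); last exact: filterT.
  by move=> n _ /=; rewrite in_itv/= -ler_norml.
have [x [_ clx]] := @segment_compact R (- M) M _ _ UM.
exists x => A Ax; have [//|UA] := in_ultra_setVsetC (v @^-1` A) UU.
by have [y [/= ]] := clx (~` A) A UA Ax.
Qed.

Lemma measure_eq_expectation (R : realType) (d : measure_display)
    (X : measurableType d) (mu nu : {measure set X -> \bar R}) (f : X -> R) :
  measure_eq mu nu -> (\int[mu]_x f x = \int[nu]_x f x)%R.
Proof.
by move=> mn; congr fine; apply: eq_measure_integral => A mA _; exact: mn.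
Qed.

Section uniqueness.
Context {R : realType} {d : nat}.
Variables (beta : R) (K : site d -> R).
Hypothesis K_sym : forall k : site d, K (- k) = K k.
Hypothesis K_fin : finite_set [set k | K k != 0].
Variable P : R.-pker config d ~> config d.
Hypothesis P_pca : pca_dynamics (pca_rule beta K) P.
Hypothesis P_attr : attractive P.
Local Notation T := (kernel_op P).
Local Notation phi := (pca_potential beta K).
Local Notation gfi := (gibbs_fin_int phi).
Variable mu : probability (config d) R.
Hypothesis mu_gibbs : gibbs phi mu.
Hypothesis mu_unique : forall nu, gibbs phi nu -> measure_eq nu mu.
Implicit Types (sigma eta tau : config d) (Lambda Gamma : {fset site d}).
Implicit Types (f g : config d -> R) (s : bool).
Local Notation E f := (\int[mu]_sigma f sigma)%R.

Let p_local := pca_rule_local beta K_sym K_fin.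
Let iter_local := local_iter p_local P_pca.

Lemma fset_sub_ball1 Lambda : \forall L \near \oo, (Lambda `<=` ball1 d L)%fset.
Proof.
exists (\sum_(k <- Lambda) norm1 k)%N => // L /= leL; apply/fsubsetP => k kL.
rewrite in_fset_set; last exact: finite_ball1.
rewrite inE /=; apply: leq_trans leL.
by rewrite (big_fsetD1 k)//= leq_addr.
Qed.

(* Every limit point of the finite volume measures is a Gibbs measure, hence
   [mu]; an ultrafilter picks one for all local functions at once. *)
Lemma gibbs_fin_int_approx s f e : local_fun f -> 0 < e ->
  exists L, gfi (ball1 d L) (const_config s) f <= E f + e.
Proof.
move=> lf e0.
have [U [UU Uoo]] := ultraFilterLemma (@eventually_filter).
pose v g L := gfi (ball1 d L) (const_config s) g.
(* Stated for all functions, with a junk value at nonlocal ones, so that choice yields a functional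
   defined everywhere. *)
have lim_ex g : exists x : R, local_fun g -> v g L @[L --> U] --> x.
  have [lg|nlg] := pselect (local_fun g); last by exists 0.
  have [M M0 gM] := local_fun_bounded lg.
  have [L|x vx] := @ultra_bounded_cvg R U (v g) M UU; last by exists x.
  have cstE c := gibbs_fin_int_cst beta K (ball1 d L) (const_config s) c.
  rewrite ler_norml -{1}(cstE (- M)) -[X in _ && (_ <= X)](cstE M).
  by apply/andP; split; apply: le_gibbs_fin_int => zeta;
    have := gM (patch zeta (const_config s)); rewrite ler_norml => /andP[].
have [l lE] := choice lim_ex.
have l_uniq g (x : R) : local_fun g -> v g L @[L --> U] --> x -> l g = x.
  by move=> lg vx; apply: (cvg_unique _ (lE g lg) vx).
have lD g h : local_fun g -> local_fun h -> l (fun u => g u + h u) = l g + l h.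
  move=> lg lh; apply: l_uniq; first exact: local_funD.
  rewrite (_ : v _ = fun L => v g L + v h L); first by apply: cvgD; exact: lE.
  by apply/funext => L; rewrite /v gibbs_fin_intD.
have lZ c g : local_fun g -> l (fun u => c * g u) = c * l g.
  move=> lg; apply: l_uniq; first exact: local_funZ.
  rewrite (_ : v _ = fun L => c * v g L); first by apply: cvgMl_tmp; exact: lE.
  by apply/funext => L; rewrite /v gibbs_fin_intZ.
have l_ge0 g : local_fun g -> (forall u, 0 <= g u) -> 0 <= l g.
  move=> lg g0; apply: (cvgr_to_ge (lE g lg)); apply: nearW => L.
  rewrite -(gibbs_fin_int_cst beta K (ball1 d L) (const_config s) 0).
  by apply: le_gibbs_fin_int => zeta.
have l1 : l (fun=> 1) = 1.
  apply: l_uniq; first exact: local_fun_cst.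
  rewrite (_ : v _ = fun=> 1); first exact: cvg_cst.
  by apply/funext => L; rewrite /v gibbs_fin_int_cst.
have [nu nuE] := functional_extension lD lZ l_ge0 l1.
have nu_gibbs : gibbs phi nu.
  apply: (gibbs_of_expectation K_sym K_fin) => Lambda g lg.
  have lgg := local_gibbs_fin_int beta K_sym K_fin Lambda lg.
  rewrite !nuE//; apply: l_uniq => //.
  (* Consistency gives equality once the ball contains [Lambda], and [U] refines the filter of large
     radii. *)
  apply: cvg_trans (lE g lg); apply: near_eq_cvg; apply: Uoo.
  apply: filterS (fset_sub_ball1 Lambda) => L LL.
  by rewrite /v gibbs_fin_int_consistent.
have lfE : l f = E f by rewrite -nuE// (measure_eq_expectation f (mu_unique nu_gibbs)).
have /cvgrPdist_le/(_ _ e0) near_e := lE f lf.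
have [L] := filter_ex near_e.
by rewrite lfE distrC ler_norml => /andP[_]; rewrite lerBlDl; exists L.
Qed.

Lemma iter_le_expectation s f e : local_fun f -> monotone_for s f -> 0 < e ->
  exists n, forall sigma, iter n T f sigma <= E f + e.
Proof.
move=> lf fs e0; have e20 : 0 < e / 2 by rewrite divr_gt0.
have [L Le] := gibbs_fin_int_approx s lf e20.
have [n ne] := iter_le_gibbs_fin_int K_sym K_fin P_pca P_attr (ball1 d L) lf fs e20.
exists n.*2 => u; apply: le_trans (ne u) _.
by rewrite [in leRHS](splitr e) addrA lerD2r.
Qed.

Definition uniform_cvg f := forall e, 0 < e ->
  exists N, forall n, (N <= n)%N -> forall sigma, `|iter n T f sigma - E f| <= e.

Lemma uniform_cvg_increasing f : local_fun f -> coord_increasing f -> uniform_cvg f.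
Proof.
move=> lf fi e e0; have mu1 := probability_setT mu.
have [n1 n1e] := iter_le_expectation lf (monotone_forT fi) e0.
have lNf : local_fun (fun u => - f u) by exact: local_fun_comp.
have [n2 n2e] := iter_le_expectation lNf (monotone_forF fi) e0.
have NE : (fun u => - f u) = (fun u => -1 * f u).
  by apply/funext => u; rewrite mulN1r.
(* An upper bound persists in time, since the kernel is positive and fixes constants. *)
have later g c N n : local_fun g -> (forall u, iter N T g u <= c) -> (N <= n)%N ->
    forall u, iter n T g u <= c.
  move=> lg gc Nn u; rewrite -(subnK Nn) iterD.
  have := le_iter_op p_local P_pca (n - N) (iter_local N lg) (local_fun_cst c) gc u.
  by rewrite iter_op_cst.
exists (maxn n1 n2) => n; rewrite geq_max => /andP[n1n n2n] u.
have h1 := later _ _ _ _ lf n1e n1n u.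
have h2 := later _ _ _ _ lNf n2e n2n u.
move: h2; rewrite NE (iter_opZ p_local P_pca)// (expectationZ mu1)// !mulN1r => h2.
by rewrite ler_norml; apply/andP; split; lra.
Qed.

Lemma uniform_cvg_local f : local_fun f -> uniform_cvg f.
Proof.
move=> lf e e0; have [g [lg gi gfi']] := local_fun_decomposition lf.
have lgf := local_funD lg lf; have mu1 := probability_setT mu.
have e20 : 0 < e / 2 by rewrite divr_gt0.
have [n1 n1e] := uniform_cvg_increasing lg gi e20.
have [n2 n2e] := uniform_cvg_increasing lgf gfi' e20.
exists (maxn n1 n2) => n; rewrite geq_max => /andP[n1n n2n] u.
have := n1e n n1n u; have := n2e n n2n u.
rewrite (iter_opD p_local P_pca)// (expectationD mu1)// => h2 h1.
rewrite (_ : _ - _ = (iter n T g u + iter n T f u - (E g + E f)) - (iter n T g u - E g)).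
  by rewrite (le_trans (ler_normB _ _))// (splitr e) lerD.
by ring.
Qed.

Lemma evolve_cvg_local (rho : probability (config d) R) f : local_fun f ->
  (\int[evolve P rho n]_sigma f sigma)%R @[n --> \oo] --> E f.
Proof.
move=> lf; apply/cvgrPdist_le => e e0; have [N Ne] := uniform_cvg_local lf e0.
have rho1 := probability_setT rho.
exists N => // n /= Nn; rewrite (expectation_evolve p_local P_pca)//.
have lin := iter_local n lf; have h u := Ne n Nn u.
rewrite distrC ler_norml; apply/andP; split.
  rewrite lerBrDr -(expectation_cst rho1 (- e + E f)).
  apply: (le_expectation rho1) => // [|u]; first exact: local_fun_cst.
  by have := h u; rewrite ler_norml => /andP[+ _]; rewrite lerBrDr.
rewrite lerBlDr -(expectation_cst rho1 (e + E f)).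
apply: (le_expectation rho1) => // [|u]; first exact: local_fun_cst.
by have := h u; rewrite ler_norml => /andP[_]; rewrite lerBlDr.
Qed.

(** Detailed balance gives invariance under two steps. By it, [E (T f)] is the expectation of the
    iterate of [f] at the odd time [2 N + 1], which is uniformly close to [E f]. *)
Lemma stationary_gibbs : stationary P mu.
Proof.
apply: measure_eq_local => f lf; have mu1 := probability_setT mu.
have lTf := local_kernel_op p_local P_pca lf.
rewrite (expectation_step p_local P_pca)//; apply/eqP; rewrite -subr_eq0.
rewrite -normr_le0; apply/ler_addgt0Pr => e e0; rewrite add0r.
have [N Ne] := uniform_cvg_local lf e0.
rewrite -(gibbs_iter K_sym K_fin P_pca mu_gibbs N lTf) -iterSr.
have lin := iter_local N.*2.+1 lf.
have h u : `|iter N.*2.+1 T f u - E f| <= e.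
  by apply: Ne; rewrite -addnn -addnS leq_addr.
rewrite ler_norml; apply/andP; split.
  rewrite lerBrDr -(expectation_cst mu1 (- e + E f)).
  apply: (le_expectation mu1) => // [|u]; first exact: local_fun_cst.
  by have := h u; rewrite ler_norml => /andP[+ _]; rewrite lerBrDr.
rewrite lerBlDr -(expectation_cst mu1 (e + E f)).
apply: (le_expectation mu1) => // [|u]; first exact: local_fun_cst.
by have := h u; rewrite ler_norml => /andP[_]; rewrite lerBlDr.
Qed.

Lemma stationary_iter (rho : probability (config d) R) n f : stationary P rho ->
  local_fun f -> (\int[rho]_sigma iter n T f sigma = \int[rho]_sigma f sigma)%R.
Proof.
move=> rho_st lf; elim: n => //= n IH.
rewrite -(expectation_step p_local P_pca); last exact: iter_local.
by rewrite (measure_eq_expectation _ rho_st).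
Qed.

Lemma stationary_unique (rho : probability (config d) R) :
  stationary P rho -> measure_eq rho mu.
Proof.
move=> rho_st; apply: measure_eq_local => f lf.
have := evolve_cvg_local rho lf.
rewrite (_ : (fun n => _) = fun=> (\int[rho]_sigma f sigma)%R).
  by move=> /(cvg_unique _ (cvg_cst _)); apply.
apply/funext => n; rewrite (expectation_evolve p_local P_pca)//.
exact: stationary_iter.
Qed.

End uniqueness.

(** * Weak convergence *)

Section weak_convergence.
Context {R : realType} {d : nat}.
Implicit Types (sigma eta : config d) (f : config d -> R).
Local Notation ptws := {ptws site d -> bool}.

Lemma ptws_cvg (F : set_system (config d)) sigma : Filter F ->
  (forall k, F [set eta | eta k = sigma k]) -> F --> (sigma : ptws).
Proof.
move=> FF Fs; rewrite cvg_sup => k; rewrite cvg_image; last first.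
  by rewrite eqEsubset; split=> v // _; exists (fun=> v).
move=> W /= /nbhs_singleton Wk; exists ((fun eta : config d => eta k) @^-1` W).
  by apply: filterS (Fs k) => eta /= ->.
by rewrite eqEsubset; split => [j [? + <-//]|j Wj]; exists (fun=> j).
Qed.

Lemma local_fun_continuous f : local_fun f -> continuous (f : ptws -> R).
Proof.
move=> [L fL] sigma.
have near_sigma : nbhs (sigma : ptws) (\bigcap_(k in [set` L])
    [set eta : ptws | eta k = sigma k]).
  apply: filter_bigI => k _.
  exact: (@proj_continuous (site d) (fun=> bool) k sigma _ (discrete_set1 (sigma k))).
move=> A /nbhs_singleton Afs; apply: filterS near_sigma => eta es /=.
by rewrite (fL eta sigma).
Qed.

(** Uniform continuity by compactness: otherwise some configurations and their truncations to
    growing balls share an ultrafilter limit while their values stay more than [e] apart. *)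
Lemma continuous_approx f e : continuous (f : ptws -> R) -> 0 < e ->
  exists2 g : config d -> R, local_fun g & forall sigma, `|f sigma - g sigma| <= e.
Proof.
move=> fc e0; pose rs n : config d -> config d :=
  fun sigma => patch (restr (ball1 d n) sigma) (const_config true).
suff [n ne] : exists n, forall sigma, `|f sigma - f (rs n sigma)| <= e.
  exists (fun u => f (rs n u)) => //; exists (ball1 d n) => u v uv.
  by rewrite /rs (eq_restr uv).
apply: contrapT => /forallNP nf.
have s_ex n : exists sigma, e < `|f sigma - f (rs n sigma)|.
  have /existsNP[sigma ns] := nf n; exists sigma.
  by rewrite ltNge; apply/negP.
have [s_ sE] := choice s_ex.
have [U [UU Uoo]] := ultraFilterLemma (@eventually_filter).
have [sigma sigmaE] := ultra_config s_ UU.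
have sk k : U [set n | s_ n k = sigma k].
  by apply: filterS (sigmaE [fset k]%fset) => n /=; apply; rewrite inE.
have cv1 : s_ n @[n --> U] --> (sigma : ptws).
  by apply: ptws_cvg => k; exact: sk.
have cv2 : rs n (s_ n) @[n --> U] --> (sigma : ptws).
  apply: ptws_cvg => k.
  have Uk : U [set n | k \in ball1 d n].
    apply: Uoo; exists (norm1 k) => // n /= kn.
    by rewrite in_fset_set ?inE//; exact: finite_ball1.
  suff : U [set n | rs n (s_ n) k = sigma k] by [].
  apply: filterS (filterI (sk k) Uk) => n [skn kn].
  exact: etrans (patch_restr_in _ _ kn) skn.
have c1 : f (s_ n) @[n --> U] --> f sigma by exact: (cvg_comp _ _ cv1 (fc sigma)).
have c2 : f (rs n (s_ n)) @[n --> U] --> f sigma by exact: (cvg_comp _ _ cv2 (fc sigma)).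
have : (f (s_ n) - f (rs n (s_ n))) @[n --> U] --> f sigma - f sigma by exact: cvgB.
rewrite subrr => /cvgrPdist_lt /(_ e e0) near_e.
have [n] := filter_ex near_e; rewrite sub0r normrN => ltn.
by have := lt_trans ltn (sE n); rewrite ltxx.
Qed.

Lemma continuous_measurable f : continuous (f : ptws -> R) ->
  measurable_fun [set: config d] f.
Proof.
move=> fc; have e0 n : 0 < (n.+1%:R : R)^-1 by rewrite invr_gt0.
have g_ex n : exists g : config d -> R, local_fun g /\
    forall sigma, `|f sigma - g sigma| <= n.+1%:R^-1.
  by have [g lg gf] := continuous_approx fc (e0 n); exists g.
have [g gE] := choice g_ex.
apply: (@measurable_fun_cvg _ _ _ _ g) => [n|sigma _].
  by have [[L gL] _] := gE n; exact: measurable_local gL.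
apply/cvgrPdist_le => e ep; near=> n; apply: le_trans (_ : n.+1%:R^-1 <= _).
  exact: (gE n).2.
by apply: ltW; near: n; exact: near_infty_natSinv_lt (PosNum ep).
Unshelve. all: by end_near. Qed.

Lemma weak_cvg_local (nu_ : nat -> probability (config d) R)
    (nu : probability (config d) R) :
  (forall f, local_fun f ->
    (\int[nu_ n]_sigma f sigma)%R @[n --> \oo] --> (\int[nu]_sigma f sigma)%R) ->
  weak_cvg nu_ nu.
Proof.
move=> cvl f fc; apply/cvgrPdist_le => e e0.
have e30 : 0 < e / 3 by rewrite divr_gt0.
have [g lg gf] := continuous_approx fc e30.
have close (m : probability (config d) R) :
    `|(\int[m]_sigma f sigma)%R - (\int[m]_sigma g sigma)%R| <= e / 3.
  have [M M0 gM] := local_fun_bounded lg; have [L gL] := lg.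
  have m1 := probability_setT m.
  have bint (h : config d -> R) C : measurable_fun [set: config d] h -> (forall u, `|h u| <= C) ->
      m.-integrable setT (EFin \o h).
    move=> mh hC; apply: (measurable_bounded_integrable measurableT) => //.
      by rewrite [ltLHS]m1 ltry.
    by exists C; split; [exact: num_real|move=> x Cx t _ /=; exact: le_trans (hC t) (ltW Cx)].
  have mf := continuous_measurable fc; have mg := measurable_local gL.
  have fM u : `|f u| <= e / 3 + M.
    by rewrite -(subrK (g u) (f u)) (le_trans (ler_normD _ _))// lerD.
  have fi := bint _ _ mf fM; have gi := bint _ _ mg gM.
  rewrite -RintegralB//; apply: le_trans (le_normr_Rintegral _ _) _ => //.
    by apply: (bint _ (e / 3)); [exact: measurable_funB|exact: gf].
  rewrite -[leRHS](expectation_cst m1); apply: le_Rintegral => //.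
  - apply: (bint _ (e / 3)) => [|u]; last by rewrite normr_id.
    by apply: measurableT_comp => //; exact: measurable_funB.
  - by apply: (bint _ (e / 3)) => [|u]; [exact: measurable_cst|rewrite ger0_norm// ltW].
have /cvgrPdist_le /(_ _ e30)[N _ Ne] := cvl g lg.
exists N => // n Nn; have := Ne n Nn; have := close nu; have := close (nu_ n).
rewrite !ler_norml => /andP[? ?] /andP[? ?] /andP[? ?]; apply/andP; split; lra.
Qed.

End weak_convergence.

(** * The rate of convergence *)

Lemma card_ball1 (d L : nat) : (#|` ball1 d L| <= (L + L).+1 ^ d)%N.
Proof.
pose h (k : site d) : {ffun 'I_d -> 'I_(L + L).+1} :=
  [ffun i => inord (absz (k ord0 i + L%:Z))].
have bnd (k : site d) i : k \in ball1 d L -> 0 <= k ord0 i + L%:Z <= (L + L)%:Z.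
  rewrite in_fset_set; last exact: finite_ball1.
  rewrite inE /= => kL; have : `|k ord0 i| <= L%:Z.
    rewrite -abszE lez_nat; apply: leq_trans kL.
    by rewrite /norm1 (bigD1 i)//= leq_addr.
  by rewrite ler_norml => /andP[l u]; rewrite -lerBlDr sub0r l /= PoszD lerD2r.
have h_inj : {in enum_fset (ball1 d L) &, injective h}.
  move=> k l kL lL /ffunP kl; apply/rowP => i; have := kl i.
  rewrite !ffunE => /(congr1 (@nat_of_ord _)).
  have /andP[k0 kLL] := bnd k i kL; have /andP[l0 lLL] := bnd l i lL.
  rewrite !inordK ?ltnS -?lez_nat ?gez0_abs// => /(congr1 Posz).
  by rewrite !gez0_abs// => /addIr.
rewrite -(size_map h).
have /card_uniqP <- : uniq (map h (ball1 d L)) by rewrite map_inj_in_uniq ?fset_uniq.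
by apply: leq_trans (max_card _) _; rewrite card_ffun !card_ord.
Qed.

(** * Translation invariance *)

Section translation.
Context {R : realType} {d : nat}.
Variables (beta : R) (K : site d -> R).
Hypothesis K_sym : forall k : site d, K (- k) = K k.
Hypothesis K_fin : finite_set [set k | K k != 0].
Variable P : R.-pker config d ~> config d.
Hypothesis P_pca : pca_dynamics (pca_rule beta K) P.
Implicit Types (sigma eta : config d) (f : config d -> R) (k x : site d).
Local Notation T := (kernel_op P).

Definition shift x sigma : config d := fun k => sigma (k + x).

Lemma pca_rule_shift k x s eta :
  pca_rule beta K k s (shift x eta) = pca_rule beta K (k + x) s eta.
Proof.
rewrite /pca_rule; congr (_ * (1 + _ * tanh (_ * _))).
rewrite [RHS](reindex_fsbigT (fun j : site d => j + x)) /=; last first.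
  by exists (fun j => j - x) => j; rewrite ?addrK ?subrK.
by apply: eq_fsbigr => j _; rewrite opprD addrACA subrr addr0.
Qed.

Lemma kernel_op_shift x f : local_fun f ->
  T (fun sigma => f (shift x sigma)) = fun eta => T f (shift x eta).
Proof.
move=> [L fL]; pose tau : config d := const_config true; apply/funext => eta.
rewrite (kernel_opE P_pca tau (shift x eta) fL).
pose L' := [fset (k + x)%R | k in L]%fset.
have cylE sigma s : \1_(cylinder L sigma) (shift x s) =
    \1_(cylinder L' (shift (- x) sigma)) s :> R.
  rewrite !indicE; congr (nat_of_bool _)%:R; apply/idP/idP => /set_mem h; apply: mem_set.
    by move=> _ /imfsetP[k /= kL ->]; rewrite /shift addrK -h.
  move=> k kL; have := h (k + x); rewrite /shift addrK; apply.
  by apply/imfsetP; exists k.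
rewrite (_ : (fun s => f (shift x s)) = fun s => \sum_(zeta : {ffun L -> bool})
    f (patch zeta tau) * \1_(cylinder L' (shift (- x) (patch zeta tau))) s); last first.
  apply/funext => s; rewrite (depends_on_sum_cylinder tau _ fL).
  by apply: eq_bigr => zeta _; rewrite cylE.
have lcyl s : local_fun (\1_(cylinder L' s) : config d -> R).
  by exists L'; apply: depends_on_indic; exact: depends_on_cylinder.
rewrite /kernel_op (expectation_sum (kernel1 P eta)) => [|zeta]; last exact: local_funZ.
apply: eq_bigr => zeta _; rewrite (expectationZ (kernel1 P eta))//; congr (_ * _).
rewrite (expectation_cylinder (P eta)) (kernel_cylinder P_pca) big_imfset /=.
  by apply: eq_bigr => k _; rewrite pca_rule_shift /shift addrK.
by move=> k l _ _ /addIr.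
Qed.

Lemma iter_shift n x f : local_fun f ->
  iter n T (fun sigma => f (shift x sigma)) = fun eta => iter n T f (shift x eta).
Proof.
move=> lf; elim: n => //= n ->; rewrite kernel_op_shift//.
exact: (local_iter (pca_rule_local beta K_sym K_fin) P_pca).
Qed.

(** Constant configurations are translation invariant, so the gap at the origin controls every site
    of a box. *)
Lemma iter_spin_const n k s :
  iter n T (fun sigma => spin (sigma k)) (const_config s) =
  iter n T (fun sigma => spin (sigma 0)) (const_config s).
Proof.
have := iter_shift n k (local_fun_spin 0) => /(congr1 (fun h => h (const_config s))).
by rewrite /shift; under [X in iter n T X]eq_fun do rewrite add0r.
Qed.

End translation.

(** * From spatial mixing to a recursion in time *)

Section spatial_to_temporal.
Context {R : realType} {d : nat}.
Variables (beta : R) (K : site d -> R).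
Hypothesis K_sym : forall k : site d, K (- k) = K k.
Hypothesis K_fin : finite_set [set k | K k != 0].
Variable P : R.-pker config d ~> config d.
Hypothesis P_pca : pca_dynamics (pca_rule beta K) P.
Hypothesis P_attr : attractive P.
Local Notation T := (kernel_op P).
Local Notation phi := (pca_potential beta K).
Local Notation gfi := (gibbs_fin_int phi).
Variable mu : probability (config d) R.
Hypothesis mu_gibbs : gibbs phi mu.
Hypothesis mu_stationary : stationary P mu.
Implicit Types (sigma eta tau : config d) (Lambda Gamma : {fset site d}).
Implicit Types (f g : config d -> R) (s : bool).
Local Notation E f := (\int[mu]_sigma f sigma)%R.
Local Notation s0 := (fun sigma : config d => spin (sigma 0) : R).

Let p_local := pca_rule_local beta K_sym K_fin.
Let iter_local := local_iter p_local P_pca.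
Let mu1 := probability_setT mu.

Definition spin_gap n : R :=
  iter n T s0 (const_config true) - iter n T s0 (const_config false).

Lemma coord_increasing_spin (k : site d) :
  coord_increasing (fun sigma => spin (sigma k) : R).
Proof.
by move=> u v uv; have := uv k; rewrite /spin; case: (u k); case: (v k) => //= _; lra.
Qed.

Lemma le_const_config f sigma : coord_increasing f ->
  f (const_config false) <= f sigma <= f (const_config true).
Proof. by move=> fi; apply/andP; split; apply: fi => k; rewrite ?implybT. Qed.

Lemma monotone_le_const s f sigma : monotone_for s f -> f sigma <= f (const_config s).
Proof.
move=> fs; have /andP[] := le_const_config sigma fs.
by case: s fs => fs; rewrite /spin ?mul1r ?mulN1r ?lerN2.
Qed.

Lemma spin_gap_ge0 n : 0 <= spin_gap n.
Proof.
rewrite subr_ge0; have := coord_increasing_iter K_sym K_fin P_pca P_attr n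
  (local_fun_spin (R := R) 0) (coord_increasing_spin 0).
by move=> /(le_const_config (const_config true))/andP[].
Qed.

Lemma spin_gap_succ n : spin_gap n.+1 <= spin_gap n.
Proof.
have li := iter_local n (local_fun_spin (R := R) 0).
have fi := coord_increasing_iter K_sym K_fin P_pca P_attr n
  (local_fun_spin (R := R) 0) (coord_increasing_spin 0).
have b := kernel_op_bounds P li (fun v => le_const_config v fi).
have /andP[_ b1] := b (const_config true); have /andP[b2 _] := b (const_config false).
by rewrite /spin_gap /= lerB.
Qed.

Lemma spin_gap_le m n : (m <= n)%N -> spin_gap n <= spin_gap m.
Proof.
move=> mn; rewrite -(subnK mn); elim: (n - m)%N => // k IH.
by rewrite addSn; apply: le_trans IH; exact: spin_gap_succ.
Qed.

Lemma iter_half_spins n Lambda D :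
  iter n T (half_spins Lambda D) (const_config true) -
  iter n T (half_spins Lambda D) (const_config false) =
  \sum_(k <- Lambda) D k / 2 * spin_gap n.
Proof.
have iE s : iter n T (half_spins Lambda D) (const_config s) =
    \sum_(k <- Lambda) D k / 2 * iter n T s0 (const_config s).
  rewrite (iter_op_sum p_local P_pca) => [|k]; last exact/local_funZ/local_fun_spin.
  apply: eq_bigr => k _; rewrite (iter_opZ p_local P_pca); last exact: local_fun_spin.
  by rewrite (iter_spin_const K_sym K_fin P_pca).
by rewrite !iE -sumrB; apply: eq_bigr => k _; rewrite -mulrBr.
Qed.

(** The half spins vary at least as much as [f], so subtracting [f] does not spoil their
    monotonicity. *)
Lemma half_spins_monotone Lambda (D : site d -> R) f s :
  depends_on Lambda f -> (forall k, 0 <= D k) ->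
  (forall k u v, (forall j, j != k -> u j = v j) -> `|f u - f v| <= D k) ->
  monotone_for s (fun u => spin s * half_spins Lambda D u - f u).
Proof.
move=> fL D0 fD u v uv.
have := lipschitz_half_spins fL D0 fD uv; rewrite ler_norml => /andP[h1 h2].
by clear fL D0 fD uv; case: s; rewrite /spin ?mul1r ?mulN1r; lra.
Qed.

(* After [n] steps the spins outside the box are reset to [s]: the last [m.*2]
   steps then cost at most the finite volume expectation, up to the discrepancies
   inside the box, each of weight at most [D]. *)
Lemma iter_const_le s n m L f D : local_fun f -> monotone_for s f ->
  `|iter m.*2 T f (const_config true) - iter m.*2 T f (const_config false)| <= D ->
  iter (n + m.*2) T f (const_config s) <= gfi (ball1 d L) (const_config s) f +
    spin s * (iter n T (half_spins (ball1 d L) (fun=> D)) (const_config s) -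
              E (half_spins (ball1 d L) (fun=> D))).
Proof.
move=> lf fs fD; pose Lambda := ball1 d L; set h := half_spins _ _.
pose g := iter m.*2 T f; pose G u := g (reset Lambda s u).
have lg : local_fun g := iter_local _ lf.
have gs : monotone_for s g := monotone_iter K_sym K_fin P_pca P_attr m.*2 lf fs.
have lG : local_fun G := local_reset Lambda s g.
have lh : local_fun h := local_half_spins _ _.
have D0 : 0 <= D by apply: le_trans fD; rewrite normr_ge0.
have gD u v : `|g u - g v| <= D.
  have /andP[] := le_const_config u gs; have /andP[] := le_const_config v gs.
  move: fD; rewrite -/g ler_norml => /andP[].
  case: (s); rewrite /spin ?mul1r ?mulN1r;
    by move=> *; rewrite ler_norml; apply/andP; split; lra.
have Hs : monotone_for s (fun u => spin s * h u - G u).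
  apply: (half_spins_monotone (Lambda := Lambda)) => // [|k u v _]; last exact: gD.
  exact: (depends_on_reset s g).
have lH : local_fun (fun u => spin s * h u - G u).
  by apply: (local_fun2 (fun x y => x - y)) => //; exact: local_funZ.
have iterH u : iter n T (fun u => spin s * h u - G u) u =
    spin s * iter n T h u - iter n T G u.
  rewrite (_ : (fun u => _) = fun u => spin s * h u + -1 * G u).
    rewrite (iter_opD p_local P_pca); [|exact: local_funZ|exact: local_funZ].
    by rewrite !(iter_opZ p_local P_pca)// mulN1r.
  by apply/funext => v; rewrite mulN1r.
(* Stationarity inserts [n] steps under [E], and a monotone iterate is at most its value at the
   constant configuration. This trades the iterate of [G] for [E G] plus a gap of half spins. *)
have EH : spin s * E h - E G <=
    spin s * iter n T h (const_config s) - iter n T G (const_config s).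
  rewrite -iterH -(expectationZ mu1)// -(expectationB mu1)//; last exact: local_funZ.
  rewrite -(stationary_iter K_sym K_fin P_pca n mu_stationary lH).
  rewrite -[leRHS](expectation_cst mu1); apply: (le_expectation mu1).
  - exact: iter_local.
  - exact: local_fun_cst.
  - move=> u; apply: (@monotone_le_const s (iter n T _)).
    exact: (monotone_iter K_sym K_fin P_pca P_attr).
have gG : iter (n + m.*2) T f (const_config s) <= iter n T G (const_config s).
  rewrite iterD; apply: (le_iter_op p_local P_pca) => // u.
  exact: monotone_le_reset.
(* The finite volume measure dominates [mu], and under it the reset chain absorbs the last [m.*2]
   steps. *)
have EG : E G <= gfi Lambda (const_config s) f.
  apply: le_trans (gibbs_le_gibbs_fin_int K_sym K_fin P_pca P_attr mu_gibbs Lambda lG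
    (monotone_reset Lambda gs)) _.
  rewrite gibbs_fin_int_reset -(gibbs_fin_int_iter_reset K_sym K_fin P_pca Lambda s m f).
  apply: le_gibbs_fin_int => zeta.
  exact: (monotone_iter_le_reset K_sym K_fin P_pca P_attr).
apply: le_trans gG _; rewrite mulrBr; clear gD D0; lra.
Qed.

(** The bound for the spin with resets to +1 is added to that for minus the spin with resets to -1,
    and the two terms in [E h] cancel. The factor 1/2 is that of [half_spins], with [D] the gap at
    time [m.*2]. *)
Lemma spin_gap_recursion n m L :
  spin_gap (n + m.*2) <=
    gfi (ball1 d L) (const_config true) s0 - gfi (ball1 d L) (const_config false) s0 +
    #|` ball1 d L|%:R / 2 * (spin_gap m.*2 * spin_gap n).
Proof.
have sandwich (a b p q x y e : R) :
    a <= p + (x - e) -> - b <= - q + - (y - e) -> a - b <= p - q + (x - y) by lra.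
have ls0 := local_fun_spin (R := R) (0 : site d).
have is0 := coord_increasing_spin 0.
have lNs0 : local_fun (fun u => - s0 u) by exact: local_fun_comp.
have iterN k u : iter k T (fun u => - s0 u) u = - iter k T s0 u.
  rewrite (_ : (fun u => - s0 u) = fun u => -1 * s0 u).
    by rewrite (iter_opZ p_local P_pca)// mulN1r.
  by apply/funext => v; rewrite mulN1r.
have gfiN : gfi (ball1 d L) (const_config false) (fun u => - s0 u) =
    - gfi (ball1 d L) (const_config false) s0.
  rewrite -mulN1r -gibbs_fin_intZ; apply: eq_gibbs_fin_int => zeta.
  by rewrite mulN1r.
have gapE : `|spin_gap m.*2| <= spin_gap m.*2 by rewrite ger0_norm// spin_gap_ge0.
have := iter_const_le n L ls0 (monotone_forT is0) gapE.
have := iter_const_le n L lNs0 (monotone_forF is0) (m := m) (D := spin_gap m.*2).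
rewrite !iterN gfiN -opprD normrN => /(_ gapE); set h := half_spins _ _.
have hE := iter_half_spins n (ball1 d L) (fun=> spin_gap m.*2).
rewrite -/h big_const_seq count_predT iter_addr_0 -[RHS]mulr_natl in hE.
rewrite [spin true]/spin [spin false]/spin mul1r mulN1r => h1 h2; rewrite {1}/spin_gap.
have -> : #|` ball1 d L|%:R / 2 * (spin_gap m.*2 * spin_gap n) =
    iter n T h (const_config true) - iter n T h (const_config false).
  by apply: etrans (esym hE); ring.
exact: sandwich h2 h1.
Qed.

End spatial_to_temporal.

(** * From the recursion to exponential decay *)

Section quadratic_decay.
Context {R : realType}.

(** For the last bound, [x <= e^x] at [x = M D / (d + 1)] is raised to the power [d + 1]: the
    exponential exceeds [c D^(d+1)], so [D >= |A| / c] is enough. *)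
Lemma expR_dominates (d : nat) (A M : R) : 0 < M -> exists D : nat,
  [/\ (1 < D)%N, (d.*2.+2)%:R <= M * D%:R & A * D%:R ^+ d <= expR (M * D%:R)].
Proof.
move=> M0; pose c := (M / d.+1%:R) ^+ d.+1.
have c0 : 0 < c by rewrite exprn_gt0// divr_gt0.
pose D := (2 + Num.bound ((d.*2.+2)%:R / M) + Num.bound (`|A| / c))%N.
have D1 : (d.*2.+2)%:R / M <= D%:R.
  apply/ltW/(lt_le_trans (archi_boundP _)); first by rewrite divr_ge0// ltW.
  by rewrite ler_nat /D addnAC leq_addl.
have D2 : `|A| / c <= D%:R.
  apply/ltW/(lt_le_trans (archi_boundP _)); first by rewrite divr_ge0// ltW.
  by rewrite ler_nat leq_addl.
exists D; split.
- by rewrite /D -addnA leq_addr.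
- by rewrite mulrC -ler_pdivrMr.
- have -> : M * D%:R = d.+1%:R * (M / d.+1%:R * D%:R).
    by rewrite mulrA [d.+1%:R * _]mulrC divfK// pnatr_eq0.
  rewrite expRM_natl; apply: (@le_trans _ _ ((M / d.+1%:R * D%:R) ^+ d.+1)); last first.
    rewrite lerXn2r ?nnegrE ?expR_ge0// ?mulr_ge0// ?divr_ge0// ?(ltW M0)//.
    by rewrite (le_trans _ (expR_ge1Dx _))// lerDr.
  rewrite exprMn -/c [D%:R ^+ d.+1]exprS mulrA ler_wpM2r ?exprn_ge0//.
  by rewrite (le_trans (ler_norm _))// mulrC -ler_pdivrMr.
Qed.

(* With boxes of side [D * 2 ^ k] at time scale [2 ^ k], the bound
   [rho (2 ^ k * N) <= (3 * D) ^- d * exp (- d * (k + 1) - 2 ^ k)] reproduces itself. *)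
Lemma quadratic_decay (rho : nat -> R) (d : nat) (C M : R) :
  0 < C -> 0 < M -> (forall n, 0 <= rho n) ->
  (forall m n, (m <= n)%N -> rho n <= rho m) ->
  (forall e, 0 < e -> exists n, rho n <= e) ->
  (forall n m L, (1 < L)%N -> rho (n + m.*2)%N <=
    C * expR (- M * L%:R) + ((L + L).+1 ^ d)%:R / 2 * (rho m.*2 * rho n)) ->
  exists2 lambda : R, 0 < lambda &
  exists n1, forall n, (n1 <= n)%N -> rho n <= expR (- lambda * n%:R).
Proof.
move=> C0 M0 rho0 rho_le rho_cvg rho_rec.
(* This choice of [A] gives [2 C q e^(2d+2) <= e^(M D)] for the [q] below; [1 < D] keeps every box
   in the range [L >= 2] of the recursion. *)
have [D [D1 D2 D3]] := expR_dominates d (2 * C * 3 ^+ d * expR (d.*2.+2)%:R) M0.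
pose q : R := (3 * D%:R) ^+ d.
have D0 : 0 < D%:R :> R by rewrite ltr0n; exact: leq_trans D1.
have q0 : 0 < q by rewrite exprn_gt0// mulr_gt0.
have q1 : 1 <= q.
  by rewrite exprn_ege1// -natrM ler1n muln_gt0/=; exact: leq_trans D1.
pose b k : R := q^-1 * expR (- (d * k.+1 + 2 ^ k)%:R).
(* The initial time [N] is to be positive and even, to fit the form [m.*2] in the recursion. *)
have [m0 m0b] : exists m0, rho m0.+1.*2 <= b 0%N.
  have [|n nb] := rho_cvg (b 0%N); first by rewrite mulr_gt0 ?invr_gt0// expR_gt0.
  exists n; apply: le_trans nb; apply: rho_le.
  by rewrite -addnn; apply: leq_trans (leq_addr _ _).
pose N := m0.+1.*2.
have step k : rho (2 ^ k * N)%N <= b k.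
  elim: k => [|k IH]; first by rewrite mul1n.
  have -> : (2 ^ k.+1 * N = 2 ^ k * N + (2 ^ k * m0.+1).*2)%N.
    by rewrite expnS -mulnA mul2n -addnn /N doubleMr.
  have kk : (k.+2 <= 2 * 2 ^ k)%N.
    by rewrite mul2n -addnn -addn1 leq_add ?expn_gt0// ltn_expl.
  have L1 : (1 < D * 2 ^ k)%N by apply: leq_trans D1 _; rewrite leq_pmulr// expn_gt0.
  apply: le_trans (rho_rec _ _ _ L1) _.
  (* With [2 L + 1 <= 3 L] and [2^k <= e^k] the volume is at most [q e^(d k)], and
     [d k - 2 (d (k+1) + 2^k)] is exactly the exponent of [b k.+1]. *)
  have quad : ((D * 2 ^ k + D * 2 ^ k).+1 ^ d)%:R *
      (rho (2 ^ k * m0.+1).*2 * rho (2 ^ k * N)%N) <= b k.+1.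
    rewrite doubleMr -/N.
    have le1 : ((D * 2 ^ k + D * 2 ^ k).+1 ^ d)%:R <= q * expR (d * k)%:R.
      apply: (@le_trans _ _ (((3 * D) * 2 ^ k) ^ d)%:R).
        rewrite !natrX lerXn2r ?nnegrE ?ler0n// ler_nat -mulnA.
        move: (D * 2 ^ k)%N L1 => L L1; rewrite -addn1 (mulnDl 2 1 L) mul1n mul2n -addnn.
        by rewrite leq_add2l ltnW.
      rewrite expnMn natrM -expnM natrX natrM ler_wpM2l ?(ltW q0)//.
      rewrite natrX -[(d * k)%:R]mulr1 expRM_natl [(d * k)%N]mulnC lerXn2r ?nnegrE ?expR_ge0//.
      by rewrite (le_trans _ (expR_ge1Dx _)).
    apply: (@le_trans _ _ (q * expR (d * k)%:R * (b k * b k))).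
      by rewrite ler_pM// ?mulr_ge0// ler_pM.
    have -> : q * expR (d * k)%:R * (b k * b k) =
        q^-1 * (expR (d * k)%:R * expR (- (d * k.+1 + 2 ^ k)%:R) *
                expR (- (d * k.+1 + 2 ^ k)%:R)) by rewrite /b; field; rewrite gt_eqF.
    rewrite -!expRD ler_wpM2l ?invr_ge0 ?(ltW q0)// ler_expR.
    rewrite -addrA -opprD -natrD lerBlDr addrC lerBrDr -natrD ler_nat.
    by apply: eq_leq; rewrite !mulnS expnS; ring.
  (* The mixing term takes the other half of [b k.+1]. [C_le] is the case [k = 0]; larger scales
     follow from [2 d + 2 <= M D] and [k + 2 <= 2 * 2^k]. *)
  have lin : C * expR (- M * (D * 2 ^ k)%:R) <= b k.+1 / 2.
    rewrite ler_pdivlMr// mulrAC [_ * 2]mulrC /b.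
    have P1 : 1 <= (2 ^ k)%:R :> R by rewrite ler1n expn_gt0.
    have C_le : 2 * C <= q^-1 * expR (M * D%:R - (d.*2.+2)%:R).
      rewrite expRB mulrA ler_pdivlMr ?expR_gt0// ler_pdivlMl//.
      by apply: le_trans D3; rewrite /q exprMn; rewrite le_eqVlt; apply/orP; left; apply/eqP; ring.
    apply: (@le_trans _ _ (q^-1 * expR (M * D%:R - (d.*2.+2)%:R) *
        expR (- M * (D * 2 ^ k)%:R))); first by rewrite ler_wpM2r// expR_ge0.
    rewrite -mulrA -expRD ler_wpM2l ?invr_ge0 ?(ltW q0)// ler_expR.
    have le1 : (d * k.+2 + 2 ^ k.+1)%:R <= (d.*2.+2)%:R * (2 ^ k)%:R :> R.
      rewrite -natrM ler_nat -[d.*2.+2]addn2 mulnDl expnS leq_add2r -muln2 -mulnA.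
      by rewrite leq_mul2l kk orbT.
    have : 0 <= (M * D%:R - (d.*2.+2)%:R) * ((2 ^ k)%:R - 1) by rewrite mulr_ge0 ?subr_ge0.
    rewrite natrM; lra.
  by rewrite [leRHS]splitr lerD// mulrAC ler_wpM2r.
(* With [2^k] the largest power of two such that [2^k N <= n], one has [n <= 2^k * 2 N]; hence the 2
   in the rate. *)
exists (2 * N%:R)^-1; first by rewrite invr_gt0 mulr_gt0// ltr0n.
exists N => n Nn; pose k := trunc_log 2 (n %/ N).
have nN : (0 < n %/ N)%N by rewrite divn_gt0.
have k1 : (2 ^ k * N <= n)%N.
  by apply: leq_trans (leq_trunc_div n N); rewrite leq_mul2r trunc_logP// orbT.
have k2 : (n <= 2 ^ k * (2 * N))%N.
  rewrite mulnA -expnSr; apply: ltnW; rewrite -ltn_divLR//; exact: trunc_log_ltn.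
apply: le_trans (rho_le _ _ k1) _; apply: le_trans (step k) _.
apply: (@le_trans _ _ (expR (- (2 ^ k)%:R))).
  rewrite /b -[leRHS]mul1r ler_pM ?invr_ge0 ?(ltW q0) ?expR_ge0 ?invf_le1//.
  by rewrite ler_expR lerN2 ler_nat leq_addl.
rewrite ler_expR mulNr lerN2 mulrC ler_pdivrMr ?mulr_gt0 ?ltr0n//.
by rewrite -natrM -natrM ler_nat.
Qed.

End quadratic_decay.

(** * From the spin at the origin to all local functions *)

Section oscillation_bound.
Context {R : realType} {d : nat}.
Implicit Types (sigma eta : config d) (f : config d -> R).

Lemma triple_norm_ge f : local_fun f ->
  exists (Lambda : {fset site d}) (D : site d -> R),
  [/\ depends_on Lambda f, forall k, 0 <= D k,
      forall k sigma eta, (forall j, j != k -> sigma j = eta j) ->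
        `|f sigma - f eta| <= D k
    & ((\sum_(k <- Lambda) D k)%:E <= triple_norm f)%E].
Proof.
move=> lf; have [L fL] := lf; have [M M0 fM] := local_fun_bounded lf.
have osc_ge k sigma eta : (forall j, j != k -> sigma j = eta j) ->
    (`|f sigma - f eta|%:E <= oscillation f k)%E.
  by move=> e; apply: ereal_sup_ubound; exists sigma, eta.
have osc0 k : (0 <= oscillation f k)%E.
  by have := osc_ge k (const_config true) _ (fun _ _ => erefl); rewrite subrr normr0.
have osc_le k : (oscillation f k <= (M + M)%:E)%E.
  apply: ge_ereal_sup => _ [s [t [_ ->]]]; rewrite lee_fin.
  by rewrite (le_trans (ler_normB _ _))// lerD.
have oscE k : oscillation f k \is a fin_num.
  by rewrite ge0_fin_numE// (le_lt_trans (osc_le k))// ltry.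
exists L, (fun k => fine (oscillation f k)); split => //.
- by move=> k; exact: fine_ge0.
- by move=> k s t st; rewrite -lee_fin fineK//; exact: osc_ge.
apply: esum_ge; exists [set` L]; first by split.
rewrite fsbig_finite//= set_fsetK -sumEFin le_eqVlt; apply/orP; left; apply/eqP.
by apply: eq_bigr => k _; rewrite fineK.
Qed.

Lemma Rintegral_dirac_local sigma f : local_fun f ->
  (\int[(\d_sigma : probability (config d) R)]_eta f eta)%R = f sigma.
Proof.
move=> [L fL]; rewrite /Rintegral integral_dirac//; last first.
  by apply/measurable_EFinP; exact: measurable_local fL.
by rewrite diracT mul1e.
Qed.

Variables (beta : R) (K : site d -> R).
Hypothesis K_sym : forall k : site d, K (- k) = K k.
Hypothesis K_fin : finite_set [set k | K k != 0].
Variable P : R.-pker config d ~> config d.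
Hypothesis P_pca : pca_dynamics (pca_rule beta K) P.
Hypothesis P_attr : attractive P.
Variable mu : probability (config d) R.
Hypothesis mu_stationary : stationary P mu.
Local Notation T := (kernel_op P).

(** With [h] the half spins, [h + f] and [h - f] increase, and so do their iterates; hence the
    iterate of [f] is within [S / 2] times the gap of its value [c] at +1. Stationarity puts [E f]
    within the same distance of [c]. *)
Lemma iter_expectation_gap f : local_fun f -> exists2 S : R,
  0 <= S /\ (S%:E <= triple_norm f)%E &
  forall n sigma, `|iter n T f sigma - (\int[mu]_eta f eta)%R| <= S * spin_gap P n.
Proof.
move=> lf; have [L [D [fL D0 fD DE]]] := triple_norm_ge lf.
have p_local := pca_rule_local beta K_sym K_fin.
have mu1 := probability_setT mu.
exists (\sum_(k <- L) D k); first by split=> //; apply: sumr_ge0.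
move=> n sigma; have lh := local_half_spins L D.
pose c := iter n T f (const_config true).
have lin := local_iter p_local P_pca n lf.
have lih := local_iter p_local P_pca n lh.
have gap := iter_half_spins K_sym K_fin P_pca n L D.
pose G := \sum_(k <- L) D k / 2 * spin_gap P n.
have GE : G + G = (\sum_(k <- L) D k) * spin_gap P n.
  by rewrite /G -big_split mulr_suml/=; apply: eq_bigr => k _; rewrite -mulrDl -splitr.
have hi : coord_increasing (half_spins L D).
  move=> u v uv; rewrite -subr_ge0.
  by apply: le_trans (lipschitz_half_spins fL D0 fD uv).
have ih_inc := coord_increasing_iter K_sym K_fin P_pca P_attr n lh hi.
have combi e : (e = 1 \/ e = -1) ->
    coord_increasing (fun u => iter n T (half_spins L D) u + e * iter n T f u).
  move=> e1; rewrite (_ : (fun u => _) =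
      iter n T (fun u => half_spins L D u + e * f u)); last first.
    rewrite (iter_opD p_local P_pca)//; last exact: local_funZ.
    by rewrite (iter_opZ p_local P_pca).
  apply: (coord_increasing_iter K_sym K_fin P_pca P_attr).
    by apply: local_funD => //; exact: local_funZ.
  move=> u v uv; have := lipschitz_half_spins fL D0 fD uv.
  rewrite ler_norml => /andP[]; case: e1 => ->; rewrite ?mul1r ?mulN1r; clear D0 fD; lra.
have close u : `|iter n T f u - c| <= G.
  have /andP[_ +] := le_const_config u (combi 1 (or_introl erefl)).
  have /andP[_ +] := le_const_config u (combi (-1) (or_intror erefl)).
  have /andP[+ _] := le_const_config u ih_inc.
  rewrite !mul1r !mulN1r -/c /G -gap.
  move: (iter n T _ _) (iter n T _ _) (iter n T _ _) (iter n T _ _) => a b b' e.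
  by move=> h1 h2 h3; rewrite ler_norml; apply/andP; split; clear D0 fD; lra.
have closeE : `|(\int[mu]_eta f eta)%R - c| <= G.
  rewrite -(stationary_iter K_sym K_fin P_pca n mu_stationary lf).
  rewrite ler_norml lerBrDr lerBlDr; apply/andP; split.
    rewrite -(expectation_cst mu1 (- G + c)); apply: (le_expectation mu1) => //.
      exact: local_fun_cst.
    by move=> u; have := close u; rewrite ler_norml lerBrDr => /andP[].
  rewrite -(expectation_cst mu1 (G + c)); apply: (le_expectation mu1) => //.
    exact: local_fun_cst.
  by move=> u; have := close u; rewrite ler_norml [X in _ && X]lerBlDr => /andP[].
rewrite -(subrKA c) -GE (le_trans (ler_normD _ _))// lerD//.
by rewrite distrC; exact: closeE.
Qed.

End oscillation_bound.

Theorem theorem2 (R : realType) (d : nat) (beta : R) (K : site d -> R) (r : R)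
  (P : R.-pker config d ~> config d)
  (d_gt0 : (0 < d)%N) (beta_gt0 : 0 < beta)
  (K_sym : forall k : site d, K (- k) = K k)
  (r_gt0 : 0 < r)
  (K_range : forall k : site d, r < (norm1 k)%:R -> K k = 0)
  (P_pca : pca_dynamics (pca_rule beta K) P)
  (P_attractive : attractive P) :
  ((exists mu1 mu2 : probability (config d) R,
      [/\ gibbs (pca_potential beta K) mu1, gibbs (pca_potential beta K) mu2
        & ~ measure_eq mu1 mu2]) ->
    ~ ergodic P)
  /\
  (forall mu : probability (config d) R,
    gibbs (pca_potential beta K) mu ->
    (forall nu : probability (config d) R,
      gibbs (pca_potential beta K) nu -> measure_eq nu mu) ->
    ergodic_towards P mu /\
    (weak_mixing (pca_potential beta K) ->
      exists2 lambda : R, 0 < lambda &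
      exists n1 : nat, forall n : nat, (n1 <= n)%N ->
      forall f : config d -> R, local_fun f ->
        (ereal_sup (range (fun sigma : config d =>
           `|(\int[evolve P \d_sigma n]_eta f eta)%R
             - (\int[mu]_eta f eta)%R|%:E))
         <= 2%:E * triple_norm f * (expR (- lambda * n%:R))%:E)%E)).
Proof.
have K_fin : finite_set [set k | K k != 0].
  apply: sub_finite_set (finite_ball1 d (Num.bound r)) => k /= Kk.
  have : (norm1 k)%:R <= r by rewrite leNgt; apply: contra Kk => /K_range ->.
  move=> /le_lt_trans/(_ (archi_boundP (ltW r_gt0))); rewrite ltr_nat; exact: ltnW.
have p_local := pca_rule_local beta K_sym K_fin.
split.
  move=> [mu1 [mu2 [gibbs1 gibbs2 neq12]]] [nu [_ _ nu_cvg]]; apply: neq12.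
  (* Started from a Gibbs measure [m], expectations are constant along even times, while ergodicity
     makes them converge to those of [nu]. *)
  have gibbs_nu m : gibbs (pca_potential beta K) m -> measure_eq m nu.
    move=> m_gibbs; apply: measure_eq_local => f lf; apply/eqP.
    rewrite -subr_eq0 -normr_le0; apply/ler_addgt0Pr => e e_gt0; rewrite add0r.
    have /cvgrPdist_le/(_ _ e_gt0)[N _ Ne] := nu_cvg m f (local_fun_continuous lf).
    have := Ne N.*2; rewrite (expectation_evolve p_local P_pca)//.
    rewrite (gibbs_iter K_sym K_fin P_pca m_gibbs)// distrC; apply => /=.
    by rewrite -addnn leq_addr.
  by move=> A mA; rewrite gibbs_nu// gibbs_nu.
move=> mu mu_gibbs mu_unique.
have mu_st := stationary_gibbs K_sym K_fin P_pca P_attractive mu_gibbs mu_unique.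
split.
  split => // [rho|rho].
    exact: (stationary_unique K_sym K_fin P_pca P_attractive mu_unique).
  apply: weak_cvg_local => f lf.
  exact: (evolve_cvg_local K_sym K_fin P_pca P_attractive mu_unique).
move=> [C [M [C_gt0 M_gt0 mixing]]].
have [| |||||lambda lambda_gt0 [n1 decay]] := @quadratic_decay R (spin_gap P) d C M.
- by [].
- by [].
- exact: (spin_gap_ge0 K_sym K_fin P_pca P_attractive).
- exact: (spin_gap_le K_sym K_fin P_pca P_attractive).
(* Uniform convergence, read at the two constant configurations, makes the gap small enough to start
   the induction. *)
- move=> e e_gt0; have e2_gt0 : 0 < e / 2 by rewrite divr_gt0.
  have [N Ne] := uniform_cvg_local K_sym K_fin P_pca P_attractive mu_unique
    (local_fun_spin 0) e2_gt0.
  exists N; have := Ne N (leqnn N) (const_config true).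
  have := Ne N (leqnn N) (const_config false); rewrite !ler_norml /spin_gap.
  move: (iter N _ _ _) (iter N _ _ _) (Rintegral _ _ _) => a b c.
  by move=> /andP[? ?] /andP[? ?]; lra.
- move=> n m L L_gt1.
  apply: le_trans (spin_gap_recursion K_sym K_fin P_pca P_attractive mu_gibbs mu_st n m L) _.
  rewrite lerD ?mixing// ler_wpM2r ?mulr_ge0 ?(spin_gap_ge0 K_sym K_fin P_pca P_attractive)//.
  by rewrite ler_wpM2r// ler_nat card_ball1.
exists lambda => //; exists n1 => n n1n f lf.
have [S [S_ge0 S_le] gap] := iter_expectation_gap K_sym K_fin P_pca P_attractive mu_st lf.
apply: ge_ereal_sup => _ [sigma _ <-].
rewrite (expectation_evolve p_local P_pca)// Rintegral_dirac_local; last first.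
  exact: (local_iter p_local P_pca).
apply: (@le_trans _ _ (S * expR (- lambda * n%:R))%:E).
  rewrite lee_fin; apply: le_trans (gap n sigma) _.
  by rewrite ler_wpM2l// decay.
rewrite EFinM lee_wpmul2r ?lee_fin ?expR_ge0//.
have tn_ge0 : (0 <= triple_norm f)%E by rewrite (le_trans _ S_le)// lee_fin.
by rewrite (le_trans S_le)// -[leLHS]mul1e lee_wpmul2r// lee_fin ler1n.
Qed.
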